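(* Let $p_j\ge1$ ($j=1,\dots,k$) with $(p_1,\dots,p_k)\neq(1,\dots,1)$. Then there exist constants $\varepsilon_0>0$ and $C>0$ such that for any $u_0\in L^1(\mathbb R^n)\cap L^\infty(\mathbb R^n)$ satisfying $\|u_0\|_{L^1\cap L^\infty}\le\varepsilon_0$, the lifespan $T_m$ of the solution to the system $$\partial_tu_j-\Delta u_j=|u_{j+1}|^{p_j}\quad(1\le j\le k,\ u_{k+1}:=u_1),\qquad u(0,x)=u_0(x),$$ satisfies $$T_m\ge\begin{cases}\infty & (\alpha_{\max}<n/2),\\ C\,\|u_0\|_{L^1\cap L^\infty}^{-1/(\alpha_{\max}-n/2)} & (\alpha_{\max}>n/2).\end{cases}$$
   Context: Here $n\ge1$, $k\ge1$, $u=(u_1,\dots,u_k):[0,T)\times\mathbb R^n\to\mathbb R^k$ is the unknown, and $u_0=(u_{0,1},\dots,u_{0,k})$ is the $\mathbb R^k$-valued initial data. The lifespan $T_m$ is the supremum of all $T>0$ for which there exists a unique solution $u\in C([0,T);L^1(\mathbb R^n)\cap L^\infty(\mathbb R^n))$ of the system with initial data $u_0$; $T_m\ge\infty$ means $T_m=\infty$. The norm $\|\cdot\|_{L^1\cap L^\infty}$ is the usual norm of the intersection space. Exponents: $\alpha_{\max}=\max_{1\le j\le k}\alpha_j$, where $$\alpha_j=\frac{\sum_{h=0}^{k-2}\prod_{m=0}^{h}p_{j+m}+1}{\prod_{m=1}^{k}p_m-1}\qquad(1\le j\le k),$$ with $p_i$ interpreted as $p_{i-k}$ for $i>k$ (for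 $k=1$ the sum is empty). Equivalently, $p_j\alpha_{j+1}-\alpha_j=1$ for $1\le j\le k$, with $\alpha_{k+1}:=\alpha_1$.
   Formalization: Solutions are mild; at t=0 continuity is required only in L^1 with local L^∞ boundedness (L^∞-continuity for t>0), because no solution in C([0,T);L^1∩L^∞) exists when u_0 has no uniformly continuous representative, e.g. a small multiple of the indicator of a ball. *)

(* Defs.v *)
From HB Require Import structures.
From mathcomp Require Import all_boot all_order all_algebra.
From mathcomp Require Import all_classical all_reals all_analysis.

Set Implicit Arguments.
Unset Strict Implicit.
Unset Printing Implicit Defensive.

Import Order.TTheory GRing.Theory Num.Theory.
Import numFieldNormedType.Exports.

Local Open Scope classical_set_scope.
Local Open Scope ring_scope.

(* R^n carries the product sigma-algebra of the library on tuples, generated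
   by the coordinate projections, i.e. the Borel sets. *)
Notation Rn R n := (n.-tuple (measurableTypeR R)).

Section lebesgue_measure_Rn.
Context {R : realType}.
Local Open Scope ereal_scope.

Definition tcons n (x : (measurableTypeR R * Rn R n)%type) : Rn R n.+1 :=
  [tuple of x.1 :: x.2].

Lemma measurable_tcons n : measurable_fun [set: _] (@tcons n).
Proof. exact: measurable_cons. Qed.

Section step.
Variables (n : nat) (mu : {sigma_finite_measure set (Rn R n) -> \bar R}).

(* Shown to be sigma-finite by hand: the library declares the general
   sigma-finite instance of [\x] after one for subprobabilities, so that it is
   not inferred. *)
Definition lebesgue_step : set (Rn R n.+1) -> \bar R :=
  pushforward (@lebesgue_measure R \x mu) (@tcons n).

Let mpre A : measurable A -> measurable (@tcons n @^-1` A).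
Proof.
by move=> mA; rewrite -[X in measurable X]setTI; exact: measurable_tcons.
Qed.

Let lebesgue_step0 : lebesgue_step set0 = 0.
Proof. by rewrite /lebesgue_step /pushforward preimage_set0 measure0. Qed.

Let lebesgue_step_ge0 A : 0 <= lebesgue_step A.
Proof. exact: (measure_ge0 (@lebesgue_measure R \x mu)). Qed.

Let lebesgue_step_sigma_additive : semi_sigma_additive lebesgue_step.
Proof.
move=> F mF tF mUF; rewrite /lebesgue_step /pushforward preimage_bigcup.
apply: measure_semi_sigma_additive.
- by move=> i; exact: mpre.
- apply/trivIsetP => /= i j _ _ ij; rewrite -preimage_setI.
  by move/trivIsetP : tF => /(_ _ _ _ _ ij) ->//; rewrite preimage_set0.
- by rewrite -preimage_bigcup; exact: mpre.
Qed.

HB.instance Definition _ := isMeasure.Build _ _ _ lebesgue_step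
  lebesgue_step0 lebesgue_step_ge0 lebesgue_step_sigma_additive.

Let lebesgue_step_sigma_finite : sigma_finite setT lebesgue_step.
Proof.
have /sigma_finiteP[F [TF ndF Foo]] := sigma_finiteT (@lebesgue_measure R).
have /sigma_finiteP[G [TG ndG Goo]] := sigma_finiteT mu.
pose g (y : Rn R n.+1) : (measurableTypeR R * Rn R n)%type :=
  (thead y, [tuple of behead y]).
have gK : cancel (@tcons n) g.
  by case=> a b; rewrite /g /tcons /= theadE; congr pair; exact: val_inj.
have mg : measurable_fun setT g.
  apply/measurable_fun_pairP; split; first exact: measurable_tnth.
  exact: measurable_behead.
exists (fun i => g @^-1` (F i `*` G i)).
  rewrite -preimage_bigcup -(preimage_setT g) -setXTT TF TG; congr (g @^-1` _).
  rewrite predeqE => -[x y]; split.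
    move=> [/= [i _ Fix] [j _ Gjy]]; exists (maxn i j) => //; split.
    - by move: x Fix; exact/subsetPset/ndF/leq_maxl.
    - by move: y Gjy; exact/subsetPset/ndG/leq_maxr.
  by move=> [i _ []/= ? ?]; split; exists i.
move=> i; have [mF ltF] := Foo i; have [mG ltG] := Goo i; split.
  by rewrite -[X in measurable X]setTI; apply: mg => //; exact: measurableX.
rewrite /lebesgue_step /pushforward -comp_preimage.
have -> : g \o @tcons n = id by apply/funext => x /=; rewrite gK.
by rewrite preimage_id product_measure1E// lte_mul_pinfty// ge0_fin_numE.
Qed.

HB.instance Definition _ := Measure_isSigmaFinite.Build _ _ _ lebesgue_step
  lebesgue_step_sigma_finite.
End step.

Fixpoint lebesgue_Rn n : {sigma_finite_measure set (Rn R n) -> \bar R} :=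
  match n return {sigma_finite_measure set (Rn R n) -> \bar R} with
  | 0 => \d_([tuple] : Rn R 0)
  | m.+1 => lebesgue_step (lebesgue_Rn m)
  end.

Lemma lebesgue_Rn_box n (A : 'I_n -> set (measurableTypeR R)) :
  (forall i, measurable (A i)) ->
  lebesgue_Rn n [set x | forall i, A i (tnth x i)] =
  \prod_(i < n) lebesgue_measure (A i).
Proof.
elim: n A => [|n IH] A mA.
  by rewrite big_ord0 /= diracE mem_set// => -[].
rewrite big_ord_recl/= /lebesgue_step /pushforward.
pose B i := A (lift ord0 i).
rewrite (_ : _ @^-1` _ = A ord0 `*` [set x | forall i, B i (tnth x i)]).
  rewrite product_measure1E//; first by rewrite IH// => i; exact: mA.
  rewrite (_ : mkset _ = \bigcap_(i in [set: 'I_n])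
      ((fun x : Rn R n => tnth x i) @^-1` B i)); last first.
    by apply/seteqP; split=> x /= h i; [move=> _; exact: h|exact: h].
  apply: fin_bigcap_measurable; first exact: finite_finset.
  move=> i _; rewrite -[X in measurable X]setTI.
  by apply: measurable_tnth => //; exact: mA.
apply/seteqP; split=> -[a x] /=.
- move=> h; split; first by have := h ord0; rewrite /tcons tnth0.
  by move=> i; have := h (lift ord0 i); rewrite /tcons tnthS.
- move=> [Aa h] i; rewrite /tcons.
  case: (unliftP ord0 i) => [j|] ->; first by rewrite tnthS; exact: h.
  by rewrite tnth0.
Qed.

End lebesgue_measure_Rn.

Section exponents.
Context {R : realType} (k : nat) (p : 'I_k -> R).

(* [iter m (@ordS k) j] is the index j + m read cyclically in 'I_k. *)
Definition alpha (j : 'I_k) : R :=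
  (\sum_(h < k.-1) \prod_(m < h.+1) p (iter m (@ordS k) j) + 1)
    / (\prod_j p j - 1).

(* 0 is a neutral element here: if all p j >= 1 and some p j > 1 then every
   alpha j is positive. *)
Definition alpha_max : R := \big[Num.max/0]_j alpha j.

End exponents.

Section L1_Linfty.
Context {R : realType} {n k : nat}.
Implicit Types v w : 'I_k -> Rn R n -> R.
Local Open Scope ereal_scope.

(* The sum of the norms of the components; any other choice of a norm on R^k,
   or the maximum instead of the sum in [normL1Linfty], gives an equivalent
   norm. *)
Definition normLp (q : \bar R) v : \bar R :=
  \sum_j 'N[lebesgue_Rn n]_q [EFin \o v j].

Definition normL1Linfty v : \bar R := normLp 1 v + normLp +oo v.

Definition in_L1Linfty v : Prop :=
  forall j, v j \in Lfun (lebesgue_Rn n) 1 /\ v j \in Lfun (lebesgue_Rn n) +oo.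

Definition ae_equal v w : Prop := forall j, v j = w j %[ae lebesgue_Rn n].

End L1_Linfty.

Section solutions.
Context {R : realType} {n k : nat}.

Definition heat_kernel (t : R) (x : Rn R n) : R :=
  (4 * pi * t) `^ (- (n%:R / 2)) *
  expR (- (\sum_(i < n) (tnth x i : R) ^+ 2) / (4 * t)).

Definition tsub (x y : Rn R n) : Rn R n :=
  [tuple (tnth x i : R) - (tnth y i : R) | i < n].

Definition heat (t : R) (f : Rn R n -> R) (x : Rn R n) : R :=
  \int[lebesgue_Rn n]_y (heat_kernel t (tsub x y) * f y).

Implicit Types u : R -> 'I_k -> Rn R n -> R.

(* The class C([0,T); L^1 cap L^oo), with the usual understanding at t = 0:
   e^{t Delta} u_0 does not converge to u_0 in L^oo as t -> 0 unless u_0 has a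
   uniformly continuous representative, so at t = 0 continuity is required in
   L^1 together with boundedness in L^oo (hence weak-star continuity in L^oo).
   When u_0 has such a representative, Duhamel's formula below turns this into
   norm continuity at t = 0. *)
Definition solution_class (T : R) u : Prop :=
  [/\ forall t, t \in `[0, T[ -> in_L1Linfty (u t),
      forall t, t \in `[0, T[ ->
        (fun s => normLp 1 (fun j => u s j \- u t j))
          @ within `[0, T[ (nbhs t) --> 0%E,
      forall t, t \in `]0, T[ ->
        (fun s => normLp +oo (fun j => u s j \- u t j)) @ t --> 0%E &
      forall T', T' \in `]0, T[ ->
        exists M : R, forall t, t \in `[0, T'] -> (normLp +oo (u t) <= M%:E)%E].

(* Duhamel's formula. The integrand in s does not depend on the choice of
   representatives, and for u in the class above it is bounded on [0,t] and
   continuous on ]0,t[; the value at s = t is immaterial. *)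
Definition mild_solution (p : 'I_k -> R) (u0 : 'I_k -> Rn R n -> R) (T : R) u :
    Prop :=
  [/\ solution_class T u,
      ae_equal (u 0) u0 &
      forall t, t \in `]0, T[ ->
        ae_equal (u t) (fun j x => heat t (u0 j) x +
          \int[lebesgue_measure]_(s in `[0, t])
            heat (t - s) (fun y => `|u s (ordS j) y| `^ p j) x)].

Definition uniquely_solvable (p : 'I_k -> R) (u0 : 'I_k -> Rn R n -> R)
    (T : R) : Prop :=
  exists u, mild_solution p u0 T u /\
    forall v, mild_solution p u0 T v ->
      forall t, t \in `[0, T[ -> ae_equal (v t) (u t).

Definition lifespan (p : 'I_k -> R) (u0 : 'I_k -> Rn R n -> R) : \bar R :=
  ereal_sup [set T%:E | T in [set T | 0 < T /\ uniquely_solvable p u0 T]].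

End solutions.

(* Main.v *)
Require Import Defs.
From mathcomp Require Import all_boot all_order all_algebra.
From mathcomp Require Import all_classical all_reals all_analysis.
From mathcomp Require Import measurable_realfun ess_sup_inf ring lra.

Set Implicit Arguments.
Unset Strict Implicit.
Unset Printing Implicit Defensive.

Import Order.TTheory GRing.Theory Num.Theory.
Import numFieldNormedType.Exports.

Local Open Scope classical_set_scope.
Local Open Scope ring_scope.

(** The proof is a fixed point argument for Duhamel's formula
<<
  u_j(t) = e^{t Delta} u_{0,j} + int_0^t e^{(t-s) Delta} |u_{j+1}(s)|^{p_j} ds
>>
in a class of functions that decay like the heat flow of an integrable datum.
Write f <=_s a for the pair of bounds |f| <= a (1 + s)^{-n/2} and
int |f| <= a.

Decay. The heat kernel has mass one, hence contracts the supremum and the L1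
norm, and it is at most (4 pi t)^{-n/2}.  The first fact serves when s and t
are comparable, the second one when they are not; together ([heat_weight],
[bdd_heat_weight]) they show that f <=_s a implies
e^{(t-s) Delta} f <=_t 2^{n/2} a.  A power is harmless as well: u <=_s a gives
|u|^p <=_s a^p (1 + s)^{-(p-1)n/2}.

Existence. The system is scale invariant with u_j of size t^{-alpha_j}, which is
the meaning of the relation p_j alpha_{j+1} = alpha_j + 1 ([alpha_rec]).  Let
gap = max(0, alpha_max - n/2), b_j = alpha_j - gap and
<<
  a_j(t) = eta^{alpha_j} (1 + T)^{-gap} (1 + t)^{n/2 - b_j}   on ]0, T[.
>>
By that relation, inserting u_{j+1} <=_s a_{j+1}(s) into the integral gives
something <=_t const * eta * a_j(t): the powers of eta differ by exactly one,
and the powers of 1 + t and of 1 + T differ by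
((1 + t) / (1 + T))^{(p_j - 1) gap}, which is at most 1.  The integral in s
is one of (1 + s)^{e - 1} with e > 0; positivity of e is the place where
alpha_max <> n/2 is used.  So for a small eta, depending on n and p only, the
Duhamel map preserves the set of all u with u_j(t) <=_t a_j(t) provided that
||u_0|| (1 + T)^{gap} is below a constant ([data_size]), and Picard iteration
converges there ([picard_exists]).  If alpha_max < n/2 then gap = 0 and
every T is allowed; if alpha_max > n/2 the condition allows T of order
||u_0||^{-1/gap}.

Regularity. For s < t the kernel at time t is at least (s/t)^{n/2} times the
kernel at time s.  As both have mass one, their L1 distance is at most
2 (1 - (s/t)^{n/2}) <= 2 n (t - s)/t ([heat_kernel_ratio],
[heat_kernel_L1_dist]).  This Lipschitz bound is all that continuity in time
requires at t > 0; continuity in L1 at t = 0 ([heat_err_cvg0]) is reduced by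
density to indicators of open sets, where it follows from the Gaussian tail.

Uniqueness ([mild_unique]). Two solutions are bounded on [0, t1], so that the
nonlinearity is Lipschitz along them; in the supremum norm weighted by a large
power of 1 + t the Duhamel map halves their distance, as often as one likes. *)

(** * Integrals of real functions and kernel operators *)
Section Rintegral_extra.
Context d (T : measurableType d) (R : realType).

Lemma le_abs_Rintegral (mu : {measure set T -> \bar R}) (D : set T)
    (g : T -> R) : measurable D -> measurable_fun D g ->
  (`|\int[mu]_(x in D) g x|%:E <= \int[mu]_(x in D) `|g x|%:E)%E.
Proof.
move=> mD mg; apply: (@le_trans _ _ `|\int[mu]_(x in D) (g x)%:E|%E).
  by rewrite /Rintegral; case: (integral _ _ _) => [r||] //=; rewrite ?normr0 ?leey.
apply: (le_trans (le_abse_integral _ _ _)) => //; exact/measurable_EFinP.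
Qed.

Lemma abs_Rintegral_le (mu : {measure set T -> \bar R}) (D : set T)
    (g : T -> R) (c : R) : measurable D -> measurable_fun D g ->
  (\int[mu]_(x in D) `|g x|%:E <= c%:E)%E ->
  `|\int[mu]_(x in D) g x| <= c.
Proof.
by move=> mD mg h; rewrite -lee_fin; exact: le_trans (le_abs_Rintegral _ _ _) h.
Qed.

Lemma bounded_integrable (mu : {measure set T -> \bar R}) (D : set T)
    (g : T -> R) (c : R) : measurable D -> measurable_fun D g ->
  (\int[mu]_(x in D) `|g x|%:E <= c%:E)%E ->
  mu.-integrable D (EFin \o g).
Proof.
move=> mD mg h; apply/integrableP; split; first exact/measurable_EFinP.
by apply: le_lt_trans h _; rewrite ltry.
Qed.

End Rintegral_extra.

(** Tonelli's theorem applied to the positive and to the negative part, so that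
    heat flows and Duhamel integrals of jointly measurable functions are
    measurable before any bound on them is known. *)
Lemma measurable_Rintegral d1 d2 (T1 : measurableType d1)
    (T2 : measurableType d2) (R : realType)
    (mu : {sigma_finite_measure set T2 -> \bar R}) (g : T1 -> T2 -> R) :
  measurable_fun setT (fun z : T1 * T2 => g z.1 z.2) ->
  measurable_fun setT (fun x => \int[mu]_y g x y).
Proof.
move=> mg; rewrite /Rintegral.
apply: (measurableT_comp (fine_measurable measurableT)) => //.
under eq_fun do rewrite integralE.
pose h := (fun z : T1 * T2 => (g z.1 z.2)%:E).
have mh : measurable_fun setT h by exact/measurable_EFinP.
apply: emeasurable_funB.
- have -> : (fun x => \int[mu]_y ((fun y => (g x y)%:E)^\+%E y))%E =
      fubini_F mu (h^\+)%E.
    by apply/funext => x; apply: eq_integral => y _; rewrite !funeposE.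
  apply: measurable_fun_fubini_tonelli_F => //.
  exact: measurable_funepos.
- have -> : (fun x => \int[mu]_y ((fun y => (g x y)%:E)^\-%E y))%E =
      fubini_F mu (h^\-)%E.
    by apply/funext => x; apply: eq_integral => y _; rewrite !funenegE.
  apply: measurable_fun_fubini_tonelli_F => //.
  exact: measurable_funeneg.
Qed.

Section schur.
Context d (T : measurableType d) (R : realType).
Variables (mu : {sigma_finite_measure set T -> \bar R}) (k : T -> T -> R).
Variable (kap : R).
Hypothesis mk : measurable_fun setT (fun z : T * T => k z.1 z.2).

Let mk1 x : measurable_fun setT (k x).
Proof. exact: (measurable_fun_pair2 x mk). Qed.

(** The Schur test: a bound on the rows of a kernel controls the operator in the
    supremum norm, and a bound on its columns controls it in L1.  It is used both
    for the heat kernel and for the difference of two heat kernels. *)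
Lemma schur_sup (f : T -> R) (c : R) x :
  (\int[mu]_y `|k x y|%:E <= kap%:E)%E ->
  measurable_fun setT f -> (forall y, `|f y| <= c) ->
  (\int[mu]_y `|k x y * f y|%:E <= (kap * c)%:E)%E.
Proof.
move=> hk mf fc; have c0 : 0 <= c by exact: le_trans (fc x).
apply: (@le_trans _ _ (\int[mu]_y (`|k x y|%:E * c%:E))%E).
  apply: ge0_le_integral => //.
  - by apply/measurable_EFinP/measurableT_comp => //; exact: measurable_funM.
  - apply: emeasurable_funM; last exact: measurable_cst.
    by apply/measurable_EFinP/measurableT_comp.
  - by move=> y _; rewrite -EFinM lee_fin normrM ler_wpM2l.
rewrite ge0_integralZr//=.
  by rewrite EFinM lee_pmul// integral_ge0.
by apply/measurable_EFinP/measurableT_comp.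
Qed.

Lemma schur_L1 (f : T -> R) :
  (forall y, (\int[mu]_x `|k x y|%:E <= kap%:E)%E) ->
  measurable_fun setT f ->
  (\int[mu]_x `|\int[mu]_y (k x y * f y)|%:E
     <= kap%:E * \int[mu]_y `|f y|%:E)%E.
Proof.
move=> hk mf.
have mkf : measurable_fun setT (fun z : T * T => k z.1 z.2 * f z.2).
  by apply: measurable_funM => //; exact: measurableT_comp.
have mkfe : measurable_fun setT (fun z : T * T => `|k z.1 z.2 * f z.2|%:E).
  by apply/measurable_EFinP/measurableT_comp.
apply: (@le_trans _ _ (\int[mu]_x \int[mu]_y `|k x y * f y|%:E)%E).
  apply: ge0_le_integral => //.
  - apply/measurable_EFinP/measurableT_comp => //.
    exact: (@measurable_Rintegral _ _ _ _ _ _ (fun x y => k x y * f y)).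
  - exact: (@measurable_fun_fubini_tonelli_F _ _ _ _ _ mu _ mkfe).
  - move=> x _; apply: le_abs_Rintegral => //.
    exact: (measurable_fun_pair2 x mkf).
rewrite (fubini_tonelli (fun z : T * T => `|k z.1 z.2 * f z.2|%:E))//=.
rewrite -ge0_integralZl//; first last.
- by rewrite (le_trans _ (hk point))// integral_ge0.
- by apply/measurable_EFinP/measurableT_comp.
apply: ge0_le_integral => //.
- by move=> y _; exact: integral_ge0.
- exact: (@measurable_fun_fubini_tonelli_G _ _ _ _ _ mu _ mkfe).
- apply: emeasurable_funM; first exact: measurable_cst.
  by apply/measurable_EFinP/measurableT_comp.
move=> y _; under eq_integral do rewrite normrM EFinM.
rewrite ge0_integralZr//; last first.
  apply/measurable_EFinP/measurableT_comp => //.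
  exact: (measurable_fun_pair1 y mk).
by rewrite lee_wpmul2r.
Qed.

End schur.

(** * The heat kernel *)

Lemma integral_Rn_S (R : realType) n (F : Rn R n.+1 -> \bar R) :
  measurable_fun setT F -> (forall y, 0 <= F y)%E ->
  (\int[lebesgue_Rn n.+1]_y F y =
   \int[lebesgue_measure]_a \int[lebesgue_Rn n]_y F (tcons (a, y)))%E.
Proof.
move=> mF F0.
rewrite /= (_ : integral _ _ _ =
  (\int[pushforward (@lebesgue_measure R \x lebesgue_Rn n)%E (@tcons R n)]_y
    F y)%E)//.
rewrite ge0_integral_pushforward//=; last exact: measurable_tcons.
rewrite preimage_setT fubini_tonelli1//.
by apply: measurableT_comp => //; exact: measurable_tcons.
Qed.

Lemma integral_Rn_prod (R : realType) n (F : 'I_n -> R -> R) :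
  (forall i, measurable_fun setT (F i)) -> (forall i a, 0 <= F i a) ->
  (\int[lebesgue_Rn n]_y (\prod_i F i (tnth y i))%:E =
   \prod_i \int[lebesgue_measure]_a (F i a)%:E)%E.
Proof.
elim: n F => [|n IH] F mF F0.
  rewrite big_ord0; under eq_integral do rewrite big_ord0.
  rewrite integral_cst// mul1e; exact: diracT.
have mP m (G : 'I_m -> R -> R) : (forall i, measurable_fun setT (G i)) ->
    measurable_fun setT (fun y : Rn R m => \prod_i G i (tnth y i)).
  move=> mG; apply: measurable_prod => i _.
  apply: (measurableT_comp (mG i)); exact: measurable_tnth.
rewrite integral_Rn_S; last 2 first.
- by apply/measurable_EFinP; exact: mP.
- by move=> y; rewrite lee_fin; apply: prodr_ge0.
have pge y : 0 <= \prod_(i < n) F (lift ord0 i) (tnth (y : Rn R n) i).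
  by apply: prodr_ge0.
have mL := mP n (fun i => F (lift ord0 i)) (fun i => mF (lift ord0 i)).
have E a : (\int[lebesgue_Rn n]_y (\prod_i F i (tnth (tcons (a, y)) i))%:E =
    (F ord0 a)%:E * \prod_i \int[lebesgue_measure]_b (F (lift ord0 i) b)%:E)%E.
  rewrite -IH// -ge0_integralZl//;
    [|exact/measurable_EFinP|by move=> y _; rewrite lee_fin|by rewrite lee_fin].
  apply: eq_integral => y _; rewrite big_ord_recl tnth0 -EFinM.
  by congr (_ * _)%:E; apply: eq_bigr => i _; rewrite tnthS.
under eq_integral do rewrite E.
rewrite /= big_ord_recl ge0_integralZr//=.
- by apply/measurable_EFinP; exact: mF.
- by move=> a _; rewrite lee_fin.
- by apply: prode_ge0 => i _; apply: integral_ge0 => a _; rewrite lee_fin.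
Qed.

Section heat_kernel.
Context {R : realType}.

(** Inversion is discontinuous at 0; the formula x^-1 = x * |x|^-2 holds at 0 as
   well and reduces it to a measurable power. *)
Lemma measurable_inv : measurable_fun [set: R] (@GRing.inv R).
Proof.
rewrite (_ : @GRing.inv R = fun x => x * (`|x| `^ (-1) * `|x| `^ (-1))).
  apply: measurable_funM => //.
  apply: measurable_funM; apply: (measurableT_comp (measurable_powR _)) => //.
apply/funext => x; have [->|x0] := eqVneq x 0; first by rewrite mul0r invr0.
rewrite powRN powRr1// -invfM -expr2 real_normK ?num_real//.
by rewrite expr2 invfM mulrA mulfV// mul1r.
Qed.

Definition gauss1 (t a : R) : R :=
  (4 * pi * t) `^ (- 2^-1) * expR (- a ^+ 2 / (4 * t)).

Lemma gauss1_ge0 t a : 0 <= gauss1 t a.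
Proof. by rewrite mulr_ge0 ?powR_ge0 ?expR_ge0. Qed.

(** The Gaussian factorises over the coordinates; this reduces its mass to the
    one-dimensional normal density. *)
Lemma heat_kernel_prod n t (x : Rn R n) :
  heat_kernel t x = \prod_i gauss1 t (tnth x i).
Proof.
rewrite /heat_kernel /gauss1 big_split/= prodr_const card_ord; congr (_ * _).
  rewrite -powR_mulrn ?powR_ge0// -powRrM; congr (_ `^ _).
  by rewrite mulNr [in RHS]mulrC.
rewrite -expR_sum; congr expR.
by rewrite -sumrN mulr_suml.
Qed.

Lemma heat_kernel_ge0 n t (x : Rn R n) : 0 <= heat_kernel t x.
Proof. by rewrite mulr_ge0 ?powR_ge0 ?expR_ge0. Qed.

Lemma heat_kernel_tsubC n t (x y : Rn R n) :
  heat_kernel t (tsub x y) = heat_kernel t (tsub y x).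
Proof.
rewrite !heat_kernel_prod; apply: eq_bigr => i _.
by rewrite /gauss1 !tnth_mktuple -sqrrN opprB.
Qed.

Lemma measurable_heat_kernel d (T : measurableType d) n (a : T -> R)
    (X Y : T -> Rn R n) : measurable_fun setT a ->
  measurable_fun setT X -> measurable_fun setT Y ->
  measurable_fun setT (fun z => heat_kernel (a z) (tsub (X z) (Y z))).
Proof.
move=> ma mX mY; apply: measurable_funM.
  apply: (measurableT_comp (measurable_powR _)).
  by apply: measurable_funM => //; exact: measurable_cst.
apply: (measurableT_comp (@measurable_expR _)).
apply: measurable_funM; last first.
  apply: (measurableT_comp measurable_inv).
  by apply: measurable_funM => //; exact: measurable_cst.
apply: measurableT_comp => //; apply: measurable_sum => i.
under eq_fun do rewrite tnth_mktuple.
apply: (measurableT_comp (@exprn_measurable R setT 2)).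
apply: measurable_funB.
  exact: (measurableT_comp (measurable_tnth i) mX).
exact: (measurableT_comp (measurable_tnth i) mY).
Qed.

Lemma integral_gauss1 t a : 0 < t ->
  (\int[lebesgue_measure]_b (gauss1 t (a - b))%:E = 1)%E.
Proof.
move=> t0; rewrite -(integral_normal_pdf a (Num.sqrt (2 * t))).
apply: eq_integral => b _; congr EFin.
have s0 : Num.sqrt (2 * t) != 0 by rewrite gt_eqF// sqrtr_gt0 mulr_gt0.
rewrite normal_pdfE// /gauss1 /normal_peak /normal_fun.
rewrite sqr_sqrtr ?mulr_ge0 ?(ltW t0)//; congr (_ * _).
  rewrite powRN -powR12_sqrt; last by rewrite mulrn_wge0// !mulr_ge0 ?pi_ge0// ltW.
  by congr (_ `^ _)^-1; rewrite -mulr_natr; ring.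
by rewrite -sqrrN opprB; congr (expR (_ / _)); rewrite -mulr_natr; ring.
Qed.

Lemma integral_heat_kernel n t (x : Rn R n) : 0 < t ->
  (\int[lebesgue_Rn n]_y (heat_kernel t (tsub x y))%:E = 1)%E.
Proof.
move=> t0; under eq_integral do rewrite heat_kernel_prod.
rewrite (eq_integral (fun y : Rn R n =>
    (\prod_i (fun b => gauss1 t (tnth x i - b)) (tnth y i))%:E)); last first.
  by move=> y _; congr EFin; apply: eq_bigr => i _; rewrite tnth_mktuple.
rewrite (integral_Rn_prod (F := fun i b => gauss1 t (tnth x i - b))).
- by rewrite big1// => i _; exact: integral_gauss1.
- move=> i; apply: measurable_funM => //.
  apply: (measurableT_comp (@measurable_expR _)).
  apply: measurable_funM => //; apply: measurableT_comp => //.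
  apply: (measurableT_comp (@exprn_measurable R setT 2)).
  by apply: measurable_funB.
- by move=> i b; exact: gauss1_ge0.
Qed.

End heat_kernel.

(** * Bounds for the heat semigroup *)
Section powR_extra.
Context {R : realType}.
Implicit Types x y q th : R.

Lemma le_powRN x y q : 0 < x -> x <= y -> 0 <= q -> y `^ (- q) <= x `^ (- q).
Proof.
move=> x0 xy q0; have y0 := lt_le_trans x0 xy.
rewrite !powRN lef_pV2 ?posrE ?powR_gt0//.
by apply: ge0_ler_powR => //; rewrite nnegrE ltW.
Qed.

(** For th <= 1 the power th^q is at least th^m, and Bernoulli's inequality for
    the integer exponent m follows by induction. *)
Lemma bernoulli_powR th q m : 0 <= th -> th <= 1 -> 0 <= q -> q <= m%:R ->
  1 - m%:R * (1 - th) <= th `^ q.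
Proof.
move=> th0 th1 q0 qm.
have [->|thN0] := eqVneq th 0.
  have [->|qN0] := eqVneq q 0.
    by rewrite powRr0 subr0 mulr1 gerBl.
  rewrite powR0// subr0 mulr1 subr_le0 ler1n lt0n.
  by apply: contra_neq qN0 => m0; apply/eqP; rewrite eq_le q0 andbT; move: qm; rewrite m0.
have thp : 0 < th by rewrite lt_neqAle eq_sym thN0.
apply: (@le_trans _ _ (th ^+ m)).
  elim: m {qm} => [|m IH]; first by rewrite mul0r subr0 expr0.
  rewrite exprSr; apply: (@le_trans _ _ ((1 - m%:R * (1 - th)) * th)).
    rewrite -subr_ge0 -natr1.
    have -> : (1 - m%:R * (1 - th)) * th - (1 - (m%:R + 1) * (1 - th)) =
       m%:R * (1 - th) ^+ 2 by ring.
    by rewrite mulr_ge0// sqr_ge0.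
  by rewrite ler_wpM2r.
by rewrite -powR_mulrn//; apply: ger_powR; rewrite ?thp.
Qed.

End powR_extra.

Section heat_bounds.
Context {R : realType} {n : nat}.
Implicit Types (f g : Rn R n -> R) (t a b c : R) (x y : Rn R n).
Local Notation mu := (@lebesgue_Rn R n).
Local Notation K t := (fun x y : Rn R n => heat_kernel t (tsub x y)).

Lemma measurable_heat_kernel2 t : measurable_fun setT (fun z : Rn R n * Rn R n => K t z.1 z.2).
Proof. exact: measurable_heat_kernel. Qed.

Lemma measurable_heat_kernel1 t x : measurable_fun setT (K t x).
Proof. exact: measurable_heat_kernel. Qed.

Lemma heat_kernel_mass t x : 0 < t -> (\int[mu]_y `|K t x y|%:E = 1)%E.
Proof.
move=> t0; rewrite -(integral_heat_kernel x t0); apply: eq_integral => y _.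
by rewrite ger0_norm// heat_kernel_ge0.
Qed.

Lemma le_heat_kernel t x : 0 < t -> heat_kernel t x <= (4 * pi * t) `^ (- (n%:R / 2)).
Proof.
move=> t0; rewrite ler_piMr ?powR_ge0// -[leRHS]expR0 ler_expR.
rewrite mulNr oppr_le0 divr_ge0//; last by rewrite mulr_ge0// ltW.
by apply: sumr_ge0 => i _; rewrite sqr_ge0.
Qed.

(** The exponential factor of the Gaussian increases with time, so that only the
    normalising factors matter. *)
Lemma heat_kernel_ratio a b x : 0 < a -> a <= b ->
  (a / b) `^ (n%:R / 2) * heat_kernel a x <= heat_kernel b x.
Proof.
move=> a0 ab; have b0 := lt_le_trans a0 ab.
have p0 : 0 < 4 * pi :> R by rewrite mulr_gt0// pi_gt0.
rewrite mulrA /heat_kernel.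
have -> : (a / b) `^ (n%:R / 2) * (4 * pi * a) `^ (- (n%:R / 2)) =
    (4 * pi * b) `^ (- (n%:R / 2)).
  rewrite [in RHS](_ : 4 * pi * b = (b / a) * (4 * pi * a)); last first.
    by field; rewrite gt_eqF.
  rewrite [RHS]powRM ?divr_ge0 ?mulr_ge0 ?ltW ?pi_gt0//; congr (_ * _).
  have -> : b / a = (a / b) `^ (-1).
    by rewrite powRN powRr1 ?invf_div// divr_ge0// ltW.
  by rewrite -powRrM mulrNN mul1r.
rewrite ler_wpM2l ?powR_ge0// ler_expR !mulNr lerN2 ler_wpM2l//.
  by apply: sumr_ge0 => i _; rewrite sqr_ge0.
by rewrite lef_pV2 ?posrE ?mulr_gt0// ler_wpM2l.
Qed.

(** Let a <= b and th = (a / b)^{n/2}.  Then G_b - th G_a >= 0 has mass 1 - th,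
    and so has (1 - th) G_a; their difference G_b - G_a is thus of L1 norm at
    most 2 (1 - th), to which Bernoulli's inequality applies. *)
Lemma heat_kernel_L1_dist a b x : 0 < a -> 0 < b ->
  (\int[mu]_y `|K b x y - K a x y|%:E <= (2 * n%:R * (`|b - a| / b))%:E)%E.
Proof.
have mI t : 0 < t -> mu.-integrable setT (fun y => (K t x y)%:E).
  move=> t0; apply: (bounded_integrable (c := 1)) => //; first exact: measurable_heat_kernel1.
  by rewrite heat_kernel_mass.
have main a' b' : 0 < a' -> a' <= b' ->
    (\int[mu]_y `|K b' x y - K a' x y|%:E <= (2 * n%:R * ((b' - a') / b'))%:E)%E.
  move=> a0 ab; have b0 := lt_le_trans a0 ab.
  set th := (a' / b') `^ (n%:R / 2).
  have th1 : th <= 1.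
    have <- : 1 `^ (n%:R / 2) = 1 :> R by rewrite powR1.
    rewrite /th; apply: ge0_ler_powR => //; rewrite ?nnegrE//.
      by rewrite divr_ge0// ltW.
    by rewrite ler_pdivrMr// mul1r.
  have thB : 1 - th <= n%:R * ((b' - a') / b').
    rewrite lerBlDr -lerBlDl.
    have -> : (b' - a') / b' = 1 - a' / b' by rewrite mulrBl mulfV// gt_eqF.
    apply: bernoulli_powR => //; first by rewrite divr_ge0// ltW.
    - by rewrite ler_pdivrMr// mul1r.
    - by rewrite ler_pdivrMr// ler_peMr// ler1n.
  apply: (@le_trans _ _ (\int[mu]_y ((K b' x y)%:E - (th * K a' x y)%:E
      + ((1 - th) * K a' x y)%:E))%E).
    apply: ge0_le_integral => //.
    - apply/measurable_EFinP/measurableT_comp => //.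
      by apply: measurable_funB; exact: measurable_heat_kernel1.
    - apply/measurable_EFinP; apply: measurable_funD; [apply: measurable_funB|];
       [|apply: measurable_funM|apply: measurable_funM] => //;
       exact: measurable_heat_kernel1.
    - move=> y _; rewrite -EFinB -EFinD lee_fin.
      have := heat_kernel_ratio (tsub x y) a0 ab; rewrite -/th => h.
      have := heat_kernel_ge0 a' (tsub x y) => h'.
      have -> : K b' x y - K a' x y =
         (K b' x y - th * K a' x y) - (1 - th) * K a' x y by ring.
      apply: le_trans (ler_normB _ _) _; rewrite lerD//.
        by rewrite ger0_norm// subr_ge0.
      by rewrite ger0_norm// mulr_ge0// subr_ge0.
  have mZ c t : 0 < t -> mu.-integrable setT (fun y => (c * K t x y)%:E).
    by move=> t0; under eq_fun do rewrite EFinM; exact/integrableZl/mI.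
  rewrite integralD//; [|apply: integrableB|] => //; [|exact: mI|exact: mZ|exact: mZ].
  rewrite integralB//; [|exact: mI|exact: mZ].
  under [X in (_ - X + _)%E]eq_integral do rewrite EFinM.
  under [X in (_ + X)%E]eq_integral do rewrite EFinM.
  rewrite !integralZl//; [|exact: mI|exact: mI].
  rewrite !integral_heat_kernel// !mule1 -EFinB -EFinD lee_fin.
  by rewrite -mulrA mulr_natl mulr2n; exact: lerD.
move=> a0 b0; have [ab|/ltW ba] := leP a b.
  by rewrite ger0_norm ?subr_ge0//; exact: main.
under eq_integral do rewrite distrC.
apply: le_trans (main _ _ b0 ba) _; rewrite lee_fin ler_wpM2l ?mulr_ge0//.
rewrite distrC ger0_norm ?subr_ge0// ler_wpM2l ?subr_ge0//.
by rewrite lef_pV2 ?posrE.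
Qed.

Lemma heat_kernel_L1_distC a b y : 0 < a -> 0 < b ->
  (\int[mu]_x `|K b x y - K a x y|%:E <= (2 * n%:R * (`|b - a| / b))%:E)%E.
Proof.
move=> a0 b0; apply: le_trans (heat_kernel_L1_dist y a0 b0).
rewrite le_eqVlt; apply/orP; left; apply/eqP; apply: eq_integral => x _.
by rewrite heat_kernel_tsubC (heat_kernel_tsubC a).
Qed.

Lemma measurable_heat_param d (T : measurableType d) (a : T -> R)
    (f : T -> Rn R n -> R) (X : T -> Rn R n) : measurable_fun setT a ->
  measurable_fun setT (fun z : T * Rn R n => f z.1 z.2) ->
  measurable_fun setT X ->
  measurable_fun setT (fun z => heat (a z) (f z) (X z)).
Proof.
move=> ma mf mX.
apply: (@measurable_Rintegral _ _ _ _ _ _ (fun z y => K (a z) (X z) y * f z y)).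
apply: measurable_funM => //; apply: measurable_heat_kernel => //.
- exact: measurableT_comp.
- exact: measurableT_comp.
Qed.

Lemma measurable_heat t f : measurable_fun setT f -> measurable_fun setT (heat t f).
Proof.
move=> mf; apply: (measurable_heat_param (a := cst t) (f := fun=> f) (X := id)) => //.
exact: measurableT_comp.
Qed.

Lemma heat_integrand_le t f c x : 0 < t -> measurable_fun setT f ->
  (forall y, `|f y| <= c) -> (\int[mu]_y `|K t x y * f y|%:E <= c%:E)%E.
Proof.
move=> t0 mf fc; rewrite -[leRHS]mul1e -EFinM; apply: (schur_sup (k := K t)) => //.
  exact: measurable_heat_kernel2.
by rewrite heat_kernel_mass.
Qed.

Lemma heat_integrable t f c x : 0 < t -> measurable_fun setT f ->
  (forall y, `|f y| <= c) -> mu.-integrable setT (fun y => (K t x y * f y)%:E).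
Proof.
move=> t0 mf fc; apply: (bounded_integrable (c := c)) => //; last exact: heat_integrand_le.
by apply: measurable_funM => //; exact: measurable_heat_kernel1.
Qed.

Lemma heat_sup t f c x : 0 < t -> measurable_fun setT f ->
  (forall y, `|f y| <= c) -> `|heat t f x| <= c.
Proof.
move=> t0 mf fc; apply: abs_Rintegral_le => //; last exact: heat_integrand_le.
by apply: measurable_funM => //; exact: measurable_heat_kernel1.
Qed.

Lemma heat_L1 t f : 0 < t -> measurable_fun setT f ->
  (\int[mu]_x `|heat t f x|%:E <= \int[mu]_x `|f x|%:E)%E.
Proof.
move=> t0 mf; rewrite -[leRHS]mul1e; apply: (schur_L1 (k := K t)) => //.
  exact: measurable_heat_kernel2.
move=> y; rewrite -(heat_kernel_mass y t0) le_eqVlt; apply/orP; left; apply/eqP.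
by apply: eq_integral => x _; rewrite heat_kernel_tsubC.
Qed.

Lemma heat_decay t f (d : R) x : 0 < t -> measurable_fun setT f ->
  (\int[mu]_x `|f x|%:E <= d%:E)%E ->
  `|heat t f x| <= (4 * pi * t) `^ (- (n%:R / 2)) * d.
Proof.
move=> t0 mf fd; apply: abs_Rintegral_le => //.
  by apply: measurable_funM => //; exact: measurable_heat_kernel1.
rewrite EFinM; apply: le_trans (lee_wpmul2l _ fd); last by rewrite lee_fin powR_ge0.
rewrite -ge0_integralZl//; first last.
- by rewrite lee_fin powR_ge0.
- by apply/measurable_EFinP/measurableT_comp.
apply: ge0_le_integral => //.
- apply/measurable_EFinP/measurableT_comp => //.
  by apply: measurable_funM => //; exact: measurable_heat_kernel1.
- apply: emeasurable_funM; first exact: measurable_cst.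
  by apply/measurable_EFinP/measurableT_comp.
- move=> y _; rewrite -EFinM lee_fin normrM ger0_norm ?heat_kernel_ge0//.
  by rewrite ler_wpM2r// le_heat_kernel.
Qed.

Lemma heatB t f g c x : 0 < t -> measurable_fun setT f -> measurable_fun setT g ->
  (forall y, `|f y| <= c) -> (forall y, `|g y| <= c) ->
  heat t (fun y => f y - g y) x = heat t f x - heat t g x.
Proof.
move=> t0 mf mg fc gc; rewrite /heat -RintegralB//.
- by under eq_Rintegral do rewrite mulrBr.
- exact: heat_integrable fc.
- exact: heat_integrable gc.
Qed.

Lemma heat_time a b f c x : 0 < a -> 0 < b -> measurable_fun setT f ->
  (forall y, `|f y| <= c) ->
  heat b f x - heat a f x = \int[mu]_y ((K b x y - K a x y) * f y).
Proof.
move=> a0 b0 mf fc; rewrite /heat -RintegralB//.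
- by under [RHS]eq_Rintegral do rewrite mulrBl.
- exact: heat_integrable fc.
- exact: heat_integrable fc.
Qed.

Let measurable_Kd a b :
  measurable_fun setT (fun z : Rn R n * Rn R n => K b z.1 z.2 - K a z.1 z.2).
Proof. by apply: measurable_funB; exact: measurable_heat_kernel2. Qed.

Lemma heat_time_sup a b f c x : 0 < a -> 0 < b -> measurable_fun setT f ->
  (forall y, `|f y| <= c) ->
  `|heat b f x - heat a f x| <= 2 * n%:R * (`|b - a| / b) * c.
Proof.
move=> a0 b0 mf fc; rewrite (heat_time x a0 b0 mf fc).
apply: abs_Rintegral_le => //.
  apply: measurable_funM => //.
  by apply: measurable_funB; exact: measurable_heat_kernel1.
apply: (schur_sup (k := fun x y => K b x y - K a x y)) => //.
exact: heat_kernel_L1_dist.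
Qed.

Lemma heat_time_L1 a b f c : 0 < a -> 0 < b -> measurable_fun setT f ->
  (forall y, `|f y| <= c) ->
  (\int[mu]_x `|heat b f x - heat a f x|%:E <=
   (2 * n%:R * (`|b - a| / b))%:E * \int[mu]_x `|f x|%:E)%E.
Proof.
move=> a0 b0 mf fc; under eq_integral => x _ do rewrite (heat_time x a0 b0 mf fc).
apply: (schur_L1 (k := fun x y => K b x y - K a x y)) => //.
by move=> y; exact: heat_kernel_L1_distC.
Qed.

Lemma ae_eq_heat t f g x : measurable_fun setT f -> measurable_fun setT g ->
  f = g %[ae mu] -> heat t f x = heat t g x.
Proof.
move=> mf mg fg; congr fine; apply: ae_eq_integral => //.
- by apply/measurable_EFinP/measurable_funM => //; exact: measurable_heat_kernel1.
- by apply/measurable_EFinP/measurable_funM => //; exact: measurable_heat_kernel1.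
- by apply: filterS fg => y /= + _ => ->.
Qed.

(** If 1 + t <= 2 (1 + s), the weight loses at most a factor 2^{n/2} between s
    and t and the contraction of the supremum is enough.  Otherwise t - s is
    larger than half of 1 + t and the L1 norm of f gives the decay. *)
Lemma heat_weight (s t a : R) f x : 0 <= s -> s < t -> measurable_fun setT f ->
  (forall y, `|f y| <= a * (1 + s) `^ (- (n%:R / 2))) ->
  (\int[mu]_x `|f x|%:E <= a%:E)%E -> 0 <= a ->
  `|heat (t - s) f x| <= 2 `^ (n%:R / 2) * a * (1 + t) `^ (- (n%:R / 2)).
Proof.
move=> s0 st mf fsup fL1 a0.
have q0 : 0 <= n%:R / 2 :> R by rewrite divr_ge0.
have ts : 0 < t - s by rewrite subr_gt0.
have [h|h] := leP (1 + t) (2 * (1 + s)).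
  apply: (le_trans (heat_sup x ts mf fsup)).
  rewrite [2 `^ _ * a]mulrC -mulrA ler_wpM2l//.
  have -> : (1 + s) `^ (- (n%:R / 2)) =
      2 `^ (n%:R / 2) * (2 * (1 + s)) `^ (- (n%:R / 2)).
    by rewrite powRM ?addr_ge0// mulrA (powRN 2) mulfV ?mul1r// gt_eqF// powR_gt0.
  by rewrite ler_wpM2l ?powR_ge0// le_powRN// ltr_wpDr// (le_trans s0)// ltW.
have pi2 := pi_ge2 R.
apply: (le_trans (heat_decay x ts mf fL1)).
rewrite mulrC [2 `^ _ * a]mulrC -[leRHS]mulrA ler_wpM2l//.
apply: (@le_trans _ _ ((1 + t) `^ (- (n%:R / 2)))).
  (* 4 pi (t - s) >= 1 + t, as pi >= 2 *)
  by apply: le_powRN => //; nra.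
rewrite ler_peMl ?powR_ge0//.
have := @ler_powR R 2 _ _ _ q0; rewrite powRr0; apply.
by rewrite ler1n.
Qed.

End heat_bounds.

(** * Continuity in L1 of the heat semigroup at time zero *)

Lemma dominated_cvg_L1 d (T : measurableType d) (R : realType)
    (mu : {measure set T -> \bar R}) (f_ : nat -> T -> R) (f g : T -> R) :
  (forall k, measurable_fun setT (f_ k)) -> measurable_fun setT f ->
  (forall x, f_ k x @[k --> \oo] --> f x) ->
  mu.-integrable setT (EFin \o g) -> (forall k x, `|f_ k x| <= g x) ->
  (\int[mu]_x `|f_ k x - f x|%:E)%E @[k --> \oo] --> 0%E.
Proof.
move=> mf_ mf f_f Ig f_g.
have [| | | | |_ H _] := @dominated_convergence _ _ _ mu setT measurableT
  (fun k => EFin \o f_ k) (EFin \o f) (EFin \o g).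
- by move=> k; exact/measurable_EFinP.
- exact/measurable_EFinP.
- apply: aeW => x _; apply: cvg_EFin; first by apply: nearW.
  exact: f_f.
- exact: Ig.
- by apply: aeW => x k _; rewrite /= lee_fin.
- exact: H.
Qed.

Section heat_continuity.
Context {R : realType} {n : nat}.
Implicit Types (f g : Rn R n -> R) (t : R) (x y : Rn R n) (A B : set (Rn R n)).
Local Notation mu := (@lebesgue_Rn R n).
Local Notation K t := (fun x y : Rn R n => heat_kernel t (tsub x y)).

Definition bmeas f := measurable_fun setT f /\ exists c : R, forall y, `|f y| <= c.

Lemma bmeas_lin (a : R) f g : bmeas f -> bmeas g -> bmeas (fun x => a * f x + g x).
Proof.
move=> [mf [c fc]] [mg [d gd]]; split.
  by apply: measurable_funD => //; exact: measurable_funM.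
exists (`|a| * c + d) => y; apply: le_trans (ler_normD _ _) _.
by rewrite lerD// normrM ler_wpM2l.
Qed.

Lemma bmeas_indic A : measurable A -> bmeas \1_A.
Proof.
move=> mA; split; first exact: measurable_indic.
by exists 1 => y; rewrite indicE; case: (_ \in _); rewrite ?normr1 ?normr0.
Qed.

Lemma heat_lin t (a : R) f g x : 0 < t -> bmeas f -> bmeas g ->
  heat t (fun y => a * f y + g y) x = a * heat t f x + heat t g x.
Proof.
move=> t0 [mf [c fc]] [mg [d gd]].
have If := heat_integrable x t0 mf fc; have Ig := heat_integrable x t0 mg gd.
rewrite /heat -RintegralZl// -RintegralD//.
  by under eq_Rintegral do rewrite mulrDr mulrCA.
apply: (eq_integrable _ (fun y => a%:E * (K t x y * f y)%:E)%E) => //.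
exact: integrableZl.
Qed.

Definition heat_err t f : \bar R := (\int[mu]_x `|heat t f x - f x|%:E)%E.

Let mnorm f : measurable_fun setT f -> measurable_fun setT (fun x => `|f x|%:E).
Proof. by move=> mf; apply/measurable_EFinP/measurableT_comp. Qed.

Lemma heat_err_lin t a f g : 0 < t -> bmeas f -> bmeas g ->
  (heat_err t (fun x => a * f x + g x)%R <= `|a|%:E * heat_err t f + heat_err t g)%E.
Proof.
move=> t0 bf bg; have [mf _] := bf; have [mg _] := bg.
have mhf : measurable_fun setT (fun x => heat t f x - f x).
  by apply: measurable_funB => //; exact: measurable_heat.
have mhg : measurable_fun setT (fun x => heat t g x - g x).
  by apply: measurable_funB => //; exact: measurable_heat.
rewrite /heat_err -ge0_integralZl//; [|exact: mnorm].
rewrite -ge0_integralD//; [|by apply: emeasurable_funM => //; exact: mnorm|exact: mnorm].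
apply: ge0_le_integral => //.
- apply: mnorm; apply: measurable_funB.
    by apply: measurable_heat; have [] := bmeas_lin a bf bg.
  by have [] := bmeas_lin a bf bg.
- by apply: emeasurable_funD; [apply: emeasurable_funM => //|]; exact: mnorm.
- move=> x _; rewrite heat_lin// -EFinM -EFinD lee_fin -normrM.
  rewrite (_ : _ - _ = a * (heat t f x - f x) + (heat t g x - g x)); last by ring.
  exact: ler_normD.
Qed.

Lemma heat_err_le t f : 0 < t -> measurable_fun setT f ->
  (heat_err t f <= 2%:E * \int[mu]_x `|f x|%:E)%E.
Proof.
move=> t0 mf; apply: (@le_trans _ _
    (\int[mu]_x (`|heat t f x|%:E + `|f x|%:E))%E).
  apply: ge0_le_integral => //.
  - by apply: mnorm; apply: measurable_funB => //; exact: measurable_heat.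
  - by apply: emeasurable_funD; apply: mnorm => //; exact: measurable_heat.
  - by move=> x _; rewrite -EFinD lee_fin; exact: ler_normB.
rewrite ge0_integralD//; [|by apply: mnorm; exact: measurable_heat|exact: mnorm].
by rewrite -[2]/(1 + 1)%R EFinD ge0_muleDl// !mul1e leeD2r// heat_L1.
Qed.

(** Openness for the Euclidean distance; the squared distance is what appears in
    the Gaussian. *)
Definition mopen A := forall x, A x ->
  exists2 r : R, 0 < r & forall y, \sum_(i < n) (tnth x i - tnth y i : R) ^+ 2 < r -> A y.

Lemma mopenI A B : mopen A -> mopen B -> mopen (A `&` B).
Proof.
move=> oA oB x [/oA[r r0 Ar] /oB[s s0 Bs]].
exists (Num.min r s) => [|y]; first by rewrite lt_min r0.
by rewrite lt_min => /andP[? ?]; split; [exact: Ar|exact: Bs].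
Qed.

Lemma mopen_forall (A : 'I_n -> set (Rn R n)) :
  (forall i, mopen (A i)) -> mopen [set x | forall i, A i x].
Proof.
move=> oA x Ax.
have /fin_all_exists2[r r0 rA] i : exists2 r : R, 0 < r & forall y,
    \sum_(i < n) (tnth x i - tnth y i : R) ^+ 2 < r -> A i y by exact: oA.
exists (\big[Num.min/1]_i r i) => [|y xy i].
  by apply/bigmin_gtP; split.
by apply: rA; apply: lt_le_trans xy _; exact: bigmin_le.
Qed.

Lemma mopen_coord i (a b : R) : mopen [set x | a < tnth x i < b].
Proof.
move=> x /= /andP[ax xb].
exists (Num.min (tnth x i - a) (b - tnth x i) ^+ 2).
  by rewrite exprn_gt0// lt_min !subr_gt0 ax.
move=> y xy.
have {xy} : (tnth x i - tnth y i : R) ^+ 2 < Num.min (tnth x i - a) (b - tnth x i) ^+ 2.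
  apply: le_lt_trans xy; rewrite (bigD1 i)//= lerDl.
  by apply: sumr_ge0 => j _; rewrite sqr_ge0.
rewrite -ltr_sqrt ?exprn_gt0 ?lt_min ?subr_gt0 ?ax//.
rewrite !sqrtr_sqr (@ger0_norm _ (Num.min _ _)); last first.
  by rewrite le_min !subr_ge0 !ltW.
rewrite lt_min => /andP[]; rewrite ltr_norml => /andP[_ h1].
rewrite ltr_norml => /andP[h2 _].
apply/andP; split; lra.
Qed.

(** Off the ball of squared radius r the kernel at time t is at most
    2^{n/2} e^{-r/(8t)} times the kernel at time 2t, which has mass one;
    e^{-z} <= 1/z turns the exponential into a multiple of t. *)
Lemma gauss_tail t r x A : 0 < t -> 0 < r -> measurable A ->
  (forall y, \sum_(i < n) (tnth x i - tnth y i : R) ^+ 2 < r -> A y) ->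
  `|heat t \1_A x - 1| <= 2 `^ (n%:R / 2) * (8 * t / r).
Proof.
move=> t0 r0 mA hA; have t20 : 0 < 2 * t by rewrite mulr_gt0.
have [mi [c ic]] := bmeas_indic mA.
have -> : heat t \1_A x - 1 = \int[mu]_y (K t x y * (\1_A y - 1)).
  have m1 : measurable_fun setT (fun _ : Rn R n => 1 : R) by exact: measurable_cst.
  under eq_Rintegral do rewrite mulrBr.
  rewrite RintegralB//; last 2 first.
  - exact: heat_integrable ic.
  - by apply: (@heat_integrable _ _ _ (cst 1) 1) => // y; rewrite /= normr1.
  congr (_ - _); rewrite /Rintegral; under eq_integral do rewrite mulr1.
  by rewrite integral_heat_kernel.
apply: abs_Rintegral_le => //.
  apply: measurable_funM; first exact: measurable_heat_kernel1.
  by apply: measurable_funB => //; exact: measurable_indic.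
rewrite -[leRHS]mule1 -(heat_kernel_mass x t20) -ge0_integralZl//; last 2 first.
- by apply: mnorm; exact: measurable_heat_kernel1.
- by rewrite lee_fin mulr_ge0 ?powR_ge0// divr_ge0 ?mulr_ge0// ltW.
apply: ge0_le_integral => //.
- apply: mnorm; apply: measurable_funM; first exact: measurable_heat_kernel1.
  by apply: measurable_funB => //; exact: measurable_indic.
- by apply: emeasurable_funM => //; apply: mnorm; exact: measurable_heat_kernel1.
move=> y _; rewrite -EFinM lee_fin.
have C0 : 0 <= 2 `^ (n%:R / 2) * (8 * t / r).
  by rewrite mulr_ge0 ?powR_ge0// divr_ge0 ?mulr_ge0// ltW.
rewrite indicE; have [yA|yA] := boolP (y \in A).
  by rewrite subrr mulr0 normr0 mulr_ge0.
rewrite sub0r mulrN1 normrN !ger0_norm ?heat_kernel_ge0//.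
have {yA} rS : r <= \sum_(i < n) (tnth x i - tnth y i : R) ^+ 2.
  by rewrite leNgt; apply: contra yA => h; rewrite inE; exact: hA.
rewrite /heat_kernel.
have -> : \sum_(i < n) (tnth (tsub x y) i : R) ^+ 2 =
    \sum_(i < n) (tnth x i - tnth y i : R) ^+ 2.
  by apply: eq_bigr => i _; rewrite tnth_mktuple.
set S := \sum_(i < n) _ in rS *; have S0 := lt_le_trans r0 rS.
have -> : (4 * pi * t) `^ (- (n%:R / 2)) =
    2 `^ (n%:R / 2) * (4 * pi * (2 * t)) `^ (- (n%:R / 2)) :> R.
  rewrite (_ : 4 * pi * (2 * t) = 2 * (4 * pi * t)); last by ring.
  rewrite [(2 * _) `^ _]powRM ?mulr_ge0 ?pi_ge0// ?ltW// mulrA (powRN 2) mulfV ?mul1r//.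
have key : expR (- S / (4 * t)) <= (8 * t / r) * expR (- S / (4 * (2 * t))).
  have -> : expR (- S / (4 * t)) =
      expR (- S / (4 * (2 * t))) * expR (- S / (4 * (2 * t))).
    by rewrite -expRD; congr expR; field; rewrite gt_eqF.
  rewrite ler_wpM2r ?expR_ge0// mulNr expRN.
  rewrite -[leRHS]invf_div lef_pV2 ?posrE ?expR_gt0 ?divr_gt0 ?mulr_gt0//.
  apply: le_trans (expR_ge1Dx _).
  apply: (@le_trans _ _ (S / (8 * t))).
    by rewrite ler_wpM2r// invr_ge0 mulr_ge0// ltW.
  by rewrite (_ : 4 * (2 * t) = 8 * t) ?lerDr//; ring.
rewrite [leRHS](_ : _ = 2 `^ (n%:R / 2) * (4 * pi * (2 * t)) `^ (- (n%:R / 2)) *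
  (8 * t / r * expR (- S / (4 * (2 * t))))); last by ring.
by rewrite ler_wpM2l// mulr_ge0 ?powR_ge0.
Qed.

(** Dominated convergence and limits of sets are sequential, so times tending to
    zero are first taken along a sequence. *)
Section along_sequence.
Variable u : nat -> R.
Hypotheses (u0 : forall m, 0 < u m) (ucvg : u @ \oo --> 0).

Definition heat_cvg f := forall e : R, 0 < e ->
  \forall m \near \oo, (heat_err (u m) f <= e%:E)%E.

Lemma heat_cvg_lin a f g : bmeas f -> bmeas g -> heat_cvg f -> heat_cvg g ->
  heat_cvg (fun x => a * f x + g x).
Proof.
move=> bf bg Pf Pg e e0.
have e1 : 0 < e / 2 / (`|a| + 1) by rewrite !divr_gt0// ltr_wpDl.
have e2 : 0 < e / 2 by rewrite divr_gt0.
near=> m; apply: le_trans (heat_err_lin a (u0 m) bf bg) _.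
have h1 : (heat_err (u m) f <= (e / 2 / (`|a| + 1))%:E)%E by near: m; exact: Pf.
have h2 : (heat_err (u m) g <= (e / 2)%:E)%E by near: m; exact: Pg.
rewrite [e in leRHS](splitr e) EFinD leeD//.
apply: le_trans (lee_wpmul2l _ h1) _ => //.
rewrite -EFinM lee_fin mulrCA ger_pMr// ler_pdivrMr ?ltr_wpDl//.
by rewrite mul1r lerDl.
Unshelve. all: by end_near. Qed.

Lemma heat_cvg_lim f : bmeas f -> (forall e : R, 0 < e -> exists g,
    [/\ bmeas g, heat_cvg g & (\int[mu]_x `|f x - g x|%:E <= e%:E)%E]) ->
  heat_cvg f.
Proof.
move=> bf h e e0; have e4 : 0 < e / 4 by rewrite divr_gt0.
have [g [bg Pg fg]] := h _ e4.
have bfg : bmeas (fun x => f x - g x).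
  by have := bmeas_lin (-1) bg bf; under eq_fun do rewrite mulN1r addrC.
have e2 : 0 < e / 2 by rewrite divr_gt0.
near=> m.
have -> : f = (fun x => 1 * g x + (f x - g x)).
  by apply/funext => x; rewrite mul1r addrC subrK.
apply: le_trans (heat_err_lin 1 (u0 m) bg bfg) _.
rewrite normr1 mul1e (splitr e) EFinD leeD//; first by near: m; exact: Pg.
apply: le_trans (heat_err_le (u0 m) _) _; first by case: bfg.
apply: le_trans (lee_wpmul2l _ fg) _ => //.
by rewrite -EFinM lee_fin; lra.
Unshelve. all: by end_near. Qed.

(** With h = e^{t Delta} 1_A we have 0 <= h <= 1 and int h <= mu A, hence
    int_{A^c} h <= int_A (1 - h) and int |h - 1_A| <= 2 int_A (1 - h).  On the
    open set A the integrand 1 - h tends to 0 pointwise by the Gaussian tail, and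
    it is dominated by 1_A. *)
Lemma heat_cvg_mopen A : measurable A -> mopen A -> (mu A < +oo)%E ->
  heat_cvg \1_A.
Proof.
move=> mA oA Afin; have [mi [c ic]] := bmeas_indic mA.
have i1 y : `|\1_A y : R| <= 1.
  by rewrite indicE; case: (_ \in _); rewrite ?normr1 ?normr0.
pose phi m x := (\1_A x * `|heat (u m) \1_A x - \1_A x|)%:E.
have mh m : measurable_fun setT (heat (u m) \1_A) by exact: measurable_heat.
have mphi m : measurable_fun setT (phi m).
  apply/measurable_EFinP; apply: measurable_funM => //.
  by apply: measurableT_comp => //; exact: measurable_funB.
have phi0 : (\int[mu]_x `|\1_A x * `|heat (u m) \1_A x - \1_A x| - 0|%:E)%E
    @[m --> \oo] --> 0%E.
  have hle m x : `|heat (u m) \1_A x| <= 1 by exact: heat_sup.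
  apply: (@dominated_cvg_L1 _ _ _ mu _ (cst 0) (fun x => 2 * \1_A x)).
  - by move=> m; apply/measurable_EFinP; exact: mphi.
  - exact: measurable_cst.
  - move=> x; have [xA|xA] := boolP (x \in A); last first.
      by rewrite indicE (negbTE xA); under eq_fun do rewrite mul0r; exact: cvg_cst.
    rewrite indicE xA; under eq_fun do rewrite mul1r.
    have [r r0 Ar] := oA x (set_mem xA).
    apply: (@squeeze_cvgr _ _ _ _ (cst 0) (fun m => (2 `^ (n%:R / 2) * 8 / r) * u m)).
    - apply: nearW => m /=; rewrite normr_ge0/=.
      apply: le_trans (gauss_tail (u0 m) r0 mA Ar) _.
      by rewrite le_eqVlt; apply/orP; left; apply/eqP; ring.
    - exact: cvg_cst.
    - rewrite -[X in _ --> X](mulr0 (2 `^ (n%:R / 2) * 8 / r)).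
      by apply: cvgM => //; exact: cvg_cst.
  - apply: (eq_integrable _ (fun x => 2%:E * (\1_A x)%:E)%E) => //.
    apply: integrableZl => //; apply/integrableP; split.
      exact/measurable_EFinP.
    under eq_integral => x _ do rewrite abse_EFin ger0_norm//.
    by rewrite integral_indic// setIT.
  - move=> m x; rewrite normrM normr_id ger0_norm// mulrC ler_wpM2r//.
    by apply: le_trans (ler_normB _ _) _; rewrite -[2]/(1 + 1) lerD.
have {}phi0 : (\int[mu]_x phi m x)%E @[m --> \oo] --> 0%E.
  apply: cvg_trans phi0; apply: near_eq_cvg; apply: nearW => m.
  by apply: eq_integral => x _; rewrite subr0 ger0_norm// mulr_ge0.
have err m : (heat_err (u m) \1_A <= 2%:E * \int[mu]_x phi m x)%E.
  have h0 x : 0 <= heat (u m) \1_A x.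
    by apply: Rintegral_ge0 => y _; rewrite mulr_ge0// heat_kernel_ge0.
  have muA : (\int[mu]_x (\1_A x)%:E)%E = mu A by rewrite integral_indic// setIT.
  have hA : (\int[mu]_x (heat (u m) \1_A x)%:E <= mu A)%E.
    rewrite -muA; have := heat_L1 (u0 m) mi.
    under eq_integral => x _ do rewrite ger0_norm//.
    by under [X in (_ <= X)%E -> _]eq_integral => x _ do rewrite ger0_norm//.
  (* Adding mu A to both sides replaces subtraction of extended reals. *)
  rewrite -(@leeD2rE _ (mu A)) ?ge0_fin_numE//.
  apply: le_trans (leeD2l _ hA); rewrite -[in leLHS]muA /heat_err.
  rewrite -ge0_integralZl//; last by move=> x _; rewrite lee_fin mulr_ge0.
  rewrite -!ge0_integralD//; try by [ exact: measurable_funeM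
    | exact/measurable_EFinP | move=> x _; rewrite ?lee_fin ?mulr_ge0
    | apply: mnorm; exact: measurable_funB].
  rewrite le_eqVlt; apply/orP; left; apply/eqP; apply: eq_integral => x _.
  rewrite /phi -EFinM -!EFinD; congr EFin.
  rewrite indicE; case: (x \in A) => /=; last first.
    by rewrite subr0 addr0 mul0r mulr0 add0r ger0_norm.
  have h1 : heat (u m) \1_A x <= 1.
    by have := heat_sup x (u0 m) mi i1; rewrite ler_norml => /andP[].
  by rewrite ler0_norm ?subr_le0//; ring.
move=> e e0; have e2 : (0 < (e / 2)%:E)%E by rewrite lte_fin divr_gt0.
near=> m; apply: le_trans (err m) _.
have h : (\int[mu]_x phi m x <= (e / 2)%:E)%E.
  by apply: ltW; near: m; exact: (phi0 _ (open_ereal_lt' e2)).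
apply: le_trans (lee_wpmul2l _ h) _ => //.
by rewrite -EFinM lee_fin mulrC divfK.
Unshelve. all: by end_near. Qed.

Lemma heat_cvg_dom (f_ : nat -> Rn R n -> R) f (g : Rn R n -> R) :
  (forall k, bmeas (f_ k)) -> bmeas f -> (forall k, heat_cvg (f_ k)) ->
  (forall x, f_ k x @[k --> \oo] --> f x) ->
  mu.-integrable setT (EFin \o g) -> (forall k x, `|f_ k x| <= g x) ->
  heat_cvg f.
Proof.
move=> bf_ bf hf f_f Ig f_g; apply: heat_cvg_lim => // e e0.
have mf_ k : measurable_fun setT (f_ k) by case: (bf_ k).
have := dominated_cvg_L1 mf_ (proj1 bf) f_f Ig f_g.
move=> /(_ _ (open_ereal_lt' (_ : (0 < e%:E)%E))) => /(_ _)/=.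
rewrite lte_fin => /(_ e0) [k _ /(_ k (leqnn k))] /= h.
exists (f_ k); split => //; apply: le_trans (ltW h).
by under eq_integral do rewrite distrC.
Qed.

Lemma heat_cvg_ndseq (F : nat -> set (Rn R n)) : (forall k, measurable (F k)) ->
  nondecreasing_seq F -> (mu (\bigcup_k F k) < +oo)%E ->
  (forall k, heat_cvg \1_(F k)) -> heat_cvg \1_(\bigcup_k F k).
Proof.
move=> mF ndF Ufin hF; have mU : measurable (\bigcup_k F k) by exact: bigcupT_measurable.
apply: (heat_cvg_dom (f_ := fun k => \1_(F k)) (g := \1_(\bigcup_k F k))) => //.
- by move=> k; exact: bmeas_indic.
- exact: bmeas_indic.
- move=> x; have [[k _ Fkx]|nFx] := pselect ((\bigcup_k F k) x).
    apply: cvg_near_cst; exists k => // j /= kj.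
    rewrite !indicE !mem_set//; first by exists k.
    by have /subsetPset := ndF _ _ kj; exact.
  rewrite (_ : (fun k => _) = cst (\1_(\bigcup_k F k) x)); first exact: cvg_cst.
  apply/funext => k /=; rewrite !indicE !memNset// => Fkx.
  by apply: nFx; exists k.
- apply/integrableP; split; first exact/measurable_EFinP.
  under eq_integral => x _ do rewrite abse_EFin ger0_norm//.
  by rewrite integral_indic// setIT.
- move=> k x; rewrite ger0_norm// !indicE ler_nat.
  have [xF|//] := boolP (x \in F k).
  by rewrite mem_set//; exists k => //; exact: set_mem.
Qed.

Let G : set (set (Rn R n)) := [set A | measurable A /\ mopen A].

(** The coordinate projections are measurable for the sigma-algebra generated by
    [G], because the preimages of open intervals are open. *)
Lemma measurable_sub_mopen A : measurable A -> <<s G >> A.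
Proof.
move=> mA.
have mt i : measurable_fun setT (fun x : g_sigma_algebraType G => tnth (x : Rn R n) i : R).
  apply: (measurability _ (RGenOpens.measurableE R)).
  move=> _ [_ [a [b ->]] <-]; rewrite setTI; apply: sub_sigma_algebra.
  have E : (fun x : Rn R n => tnth x i : R) @^-1` `]a, b[%classic =
     [set x | a < (tnth x i : R) < b] by apply/seteqP; split=> x /=; rewrite in_itv.
  split; last by rewrite E; exact: mopen_coord.
  rewrite -[X in measurable X]setTI; apply: measurable_tnth => //.
have : measurable_fun setT (fun x : g_sigma_algebraType G => (x : Rn R n)).
  by apply/measurable_fun_tnthP => i; exact: mt.
by move=> /(_ measurableT A mA); rewrite setTI.
Qed.

(** Dynkin's theorem inside an open set of finite measure: the measurable A for
    which the indicator of the trace on Q converges form a lambda-system that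
    contains the pi-system of open sets. *)
Lemma heat_cvg_box Q A : measurable Q -> mopen Q -> (mu Q < +oo)%E ->
  measurable A -> heat_cvg \1_(A `&` Q).
Proof.
move=> mQ oQ Qfin mA.
have H : <<s G >> `<=` [set A | measurable A /\ heat_cvg \1_(A `&` Q)].
  apply: lambda_system_subset => //.
    by move=> X Y [mX oX] [mY oY]; split; [exact: measurableI|exact: mopenI].
  - split => //.
    + by split => //; rewrite setTI; exact: heat_cvg_mopen.
    + move=> X Y YX [mX hX] [mY hY]; split; first exact: measurableD.
      rewrite (_ : \1_(_) = fun x => -1 * \1_(Y `&` Q) x + \1_(X `&` Q) x).
        by apply: heat_cvg_lin => //; apply: bmeas_indic; exact: measurableI.
      apply/funext => x; rewrite !indicE.
      have [Qx|nQx] := pselect (Q x); last by rewrite !memNset ?mulr0 ?addr0// => -[].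
      have [Yx|nYx] := pselect (Y x).
        rewrite memNset ?mem_set; [by rewrite mulr1 addNr| | |by case=> -[]] => //.
        by split=> //; exact: YX.
      rewrite (memNset (A := Y `&` Q)) ?mulr0 ?add0r; last by case.
      by congr (nat_of_bool _)%:R; apply/idP/idP; rewrite !inE => -[]; [case|].
    + move=> F ndF hF; split; first by apply: bigcupT_measurable => k; case: (hF k).
      rewrite setI_bigcupl; apply: heat_cvg_ndseq.
      * by move=> k; apply: measurableI => //; case: (hF k).
      * by move=> i j ij; apply/subsetPset; apply: setSI; apply/subsetPset; exact: ndF.
      * rewrite -setI_bigcupl; apply: le_lt_trans Qfin; apply: le_measure; rewrite ?inE//.
        apply: measurableI => //; apply: bigcupT_measurable => k; case: (hF k) => //.
      * by move=> k; case: (hF k).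
  - move=> X [mX oX]; split => //; apply: heat_cvg_mopen.
    + exact: measurableI.
    + exact: mopenI.
    + by apply: le_lt_trans Qfin; apply: le_measure; rewrite ?inE//; exact: measurableI.
by have [] := H _ (measurable_sub_mopen mA).
Qed.

Lemma heat_cvg_fin A : measurable A -> (mu A < +oo)%E -> heat_cvg \1_A.
Proof.
move=> mA Afin.
pose I k : set (measurableTypeR R) := `](- k.+1%:R), k.+1%:R[%classic.
pose Q k := [set x : Rn R n | forall i, I k (tnth x i)].
have mI k : measurable (I k) by exact: measurable_itv.
have mQ k : measurable (Q k).
  rewrite (_ : Q k = \bigcap_(i in [set: 'I_n]) ((fun x : Rn R n => tnth x i) @^-1` I k)).
    apply: fin_bigcap_measurable; first exact: finite_finset.
    move=> i _; rewrite -[X in measurable X]setTI.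
    by apply: measurable_tnth => //; exact: mI.
  by apply/seteqP; split=> x /= h i; [move=> _; exact: h|exact: h].
have Qfin k : (mu (Q k) < +oo)%E.
  rewrite /Q (lebesgue_Rn_box (A := fun=> I k))// ltey_eq.
  apply/orP; left; apply: (big_ind (fun z : \bar R => z \is a fin_num)) => //.
  - by move=> ? ? ? ?; exact: fin_numM.
  - by move=> i _; rewrite lebesgue_measure_itv; case: ifP.
have oQ k : mopen (Q k).
  apply: (mopen_forall (A := fun i => [set x | tnth x i \in `](- k.+1%:R), k.+1%:R[])).
  by move=> i x; rewrite /= in_itv; exact: mopen_coord.
have ndQ : nondecreasing_seq (fun k => A `&` Q k).
  move=> j k jk; apply/subsetPset; apply: setIS => x /= Qx i.
  have := Qx i; rewrite /I/= !in_itv/= => /andP[h1 h2]; apply/andP; split.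
    by apply: le_lt_trans h1; rewrite lerN2 ler_nat.
  by apply: lt_le_trans h2 _; rewrite ler_nat.
have AE : A = \bigcup_k (A `&` Q k).
  apply/seteqP; split=> [x Ax|x [k _ []]//].
  exists (Num.truncn (\sum_i `|tnth x i : R|)) => //; split=> // i.
  rewrite /I/= in_itv/= -ltr_norml; apply: le_lt_trans (truncnS_gt _).
  by rewrite (bigD1 i)//= lerDl sumr_ge0.
rewrite AE; apply: heat_cvg_ndseq.
- by move=> k; exact: measurableI.
- exact: ndQ.
- by rewrite -AE.
- by move=> k; exact: heat_cvg_box.
Qed.

Import HBNNSimple.

(** Approximation from below by simple functions; the level sets of a nonzero
    value have finite measure because f is integrable. *)
Lemma heat_cvg_ge0 f : bmeas f -> (forall x, 0 <= f x) ->
  mu.-integrable setT (EFin \o f) -> heat_cvg f.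
Proof.
move=> bf f0 If; have [mf [c fc]] := bf.
have mfe : measurable_fun setT (EFin \o f) by exact/measurable_EFinP.
pose g k : Rn R n -> R := nnsfun_approx measurableT mfe k.
have g0 k x : 0 <= g k x by [].
have gf k x : g k x <= f x.
  rewrite -lee_fin /g nnsfun_approxE; apply: le_approx => //.
  by move=> y _; rewrite /= lee_fin.
have mg k : measurable_fun setT (g k) by [].
have bg k : bmeas (g k).
  by split => //; exists c => y; rewrite ger0_norm// (le_trans (gf k y))//
    (le_trans (ler_norm _)).
have gcvg x : g k x @[k --> \oo] --> f x.
  have := @cvg_nnsfun_approx _ _ _ _ measurableT _ mfe _ x Logic.I.
  by move=> /(_ _)/fine_cvgP[]// y _; rewrite /= lee_fin.
apply: (heat_cvg_dom bg bf _ gcvg If); last first.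
  by move=> k x; rewrite ger0_norm.
move=> k; pose A (z : R) : set (Rn R n) := [set x | g k x = z].
have mA z : measurable (A z).
  rewrite -[A z]setTI (_ : A z = g k @^-1` [set z])//; exact: mg.
have Afin z : z != 0 -> (mu (A z) < +oo)%E.
  move=> y0; have y1 : (0 < `|z|%:E)%E by rewrite lte_fin normr_gt0.
  rewrite -(@lte_pmul2l _ `|z|%:E)// gt0_muley//.
  have /integrableP[_] := If; apply: le_lt_trans.
  have -> : mu (A z) = (\int[mu]_x (\1_(A z) x)%:E)%E by rewrite integral_indic// setIT.
  rewrite -ge0_integralZl//; last first.
    by apply/measurable_EFinP.
  apply: ge0_le_integral => //.
  - by apply: measurable_funeM; apply/measurable_EFinP.
  - by apply/measurable_EFinP/measurableT_comp.
  - move=> x _; rewrite -EFinM lee_fin indicE.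
    have [xA|_] := boolP (x \in A z); last by rewrite mulr0.
    move: xA; rewrite inE /A /= => <-; rewrite mulr1 !ger0_norm//.
have main (s : seq R) : bmeas (fun x => \sum_(z <- s) z * \1_(A z) x) /\
    heat_cvg (fun x => \sum_(z <- s) z * \1_(A z) x).
  elim: s => [|z s [IH1 IH2]].
    have E : (fun x : Rn R n => \sum_(z <- [::]) z * \1_(A z) x) = \1_set0.
      by apply/funext => x; rewrite big_nil indicE in_set0.
    rewrite E; split; first exact: bmeas_indic.
    by apply: heat_cvg_fin => //; rewrite measure0.
  have E : (fun x => \sum_(w <- z :: s) w * \1_(A w) x) =
      (fun x => z * \1_(A z) x + \sum_(w <- s) w * \1_(A w) x).
    by apply/funext => x; rewrite big_cons.
  rewrite E; split; first by apply: bmeas_lin => //; exact: bmeas_indic.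
  have [y0|y0] := eqVneq z 0.
    rewrite (_ : (fun x => _) = (fun x => \sum_(w <- s) w * \1_(A w) x))//.
    by apply/funext => x; rewrite y0 mul0r add0r.
  by apply: heat_cvg_lin => //; [exact: bmeas_indic|apply: heat_cvg_fin => //; exact: Afin].
rewrite (_ : g k = fun x => \sum_(z <- finmap.enum_fset (fset_set (range (g k)))) z * \1_(A z) x).
  by case: (main (finmap.enum_fset (fset_set (range (g k))))).
by apply/funext => x; rewrite {1}/g fimfunE fsbig_finite.
Qed.

Lemma heat_cvg_L1 f : bmeas f -> mu.-integrable setT (EFin \o f) -> heat_cvg f.
Proof.
move=> bf If; have [mf [c fc]] := bf.
have pos h : bmeas h -> mu.-integrable setT (EFin \o h) ->
    bmeas (fun x => Num.max (h x) 0) /\ heat_cvg (fun x => Num.max (h x) 0).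
  move=> [mh [d hd]] /integrableP[_ Ih].
  have hm x : `|Num.max (h x) 0| <= `|h x|.
    by case: (leP (h x) 0) => _; rewrite ?normr0.
  have mm : measurable_fun setT (fun x => Num.max (h x) 0).
    by apply: measurable_maxr => //; exact: measurable_cst.
  have bm : bmeas (fun x => Num.max (h x) 0).
    by split=> //; exists d => y; exact: le_trans (hm y) (hd y).
  split=> //; apply: heat_cvg_ge0 => //; first by move=> x; rewrite le_max lexx orbT.
  apply/integrableP; split; first exact/measurable_EFinP.
  apply: le_lt_trans Ih; apply: ge0_le_integral => //.
  - exact: mnorm.
  - exact: mnorm.
  - by move=> x _; rewrite /= lee_fin.
have bN : bmeas (fun x => - f x).
  by split; [exact: measurableT_comp|exists c => y; rewrite normrN].
have IN : mu.-integrable setT (EFin \o (fun x => - f x))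
  by apply: (eq_integrable _ (fun x => - (f x)%:E)%E) => //; exact: integrableN.
have [bp hp] := pos _ bf If; have [bn hn] := pos _ bN IN.
rewrite (_ : f = fun x => -1 * Num.max (- f x) 0 + Num.max (f x) 0).
  exact: heat_cvg_lin.
apply/funext => x; rewrite mulN1r; case: (leP (f x) 0) => h.
  by rewrite max_l ?oppr_ge0// opprK addr0.
by rewrite max_r ?oppr_le0 ?ltW// oppr0 add0r.
Qed.

End along_sequence.

Lemma heat_err_cvg0 f (e : R) : bmeas f -> mu.-integrable setT (EFin \o f) ->
  0 < e -> exists2 del : R, 0 < del &
    forall t, 0 < t -> t < del -> (heat_err t f <= e%:E)%E.
Proof.
move=> bf If e0; apply: contrapT => /forall2NP H.
have /choice[u hu] : forall m : nat, exists t,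
    [/\ 0 < t, t < m.+1%:R^-1 & ~ (heat_err t f <= e%:E)%E].
  move=> m; have [|/existsNP[t /not_implyP[t0 /not_implyP[tm he]]]] := H m.+1%:R^-1.
    by rewrite invr_gt0 ltr0n.
  by exists t.
have u0 m : 0 < u m by case: (hu m).
have ucvg : u @ \oo --> 0.
  apply: (@squeeze_cvgr _ _ _ _ (cst 0) (fun m => m.+1%:R^-1)).
  - by apply: nearW => m; case: (hu m) => ? ? _; rewrite !ltW.
  - exact: cvg_cst.
  - exact: cvg_harmonic.
have [N _ /(_ N (leqnn N))] := heat_cvg_L1 u0 ucvg bf If e0.
by case: (hu N).
Qed.

End heat_continuity.

(** * Integrals over time *)
Section time_integral.
Context {R : realType}.
Local Notation lam := (@lebesgue_measure R).
Implicit Types (h c : R -> R) (t C : R).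

Lemma Rintegral_cc_oo t h : measurable_fun `]0, t[ h ->
  \int[lam]_(s in `[0, t]) h s = \int[lam]_(s in `]0%R, t[) h s.
Proof.
move=> mh; rewrite /Rintegral; congr fine.
by apply: integral_itv_bndoo; exact/measurable_EFinP.
Qed.

Lemma eq_Rintegral_cc t (h1 h2 : R -> R) : measurable_fun `]0, t[ h1 ->
  (forall s, 0 < s -> s < t -> h1 s = h2 s) ->
  \int[lam]_(s in `[0, t]) h1 s = \int[lam]_(s in `[0, t]) h2 s.
Proof.
move=> m1 h12.
have m2 : measurable_fun `]0, t[ h2.
  apply: (eq_measurable_fun _ _ m1) => s.
  by rewrite inE/= in_itv/= => /andP[s0 st]; rewrite h12.
rewrite !Rintegral_cc_oo//; apply: eq_Rintegral => s.
by rewrite inE/= in_itv/= => /andP[s0 st]; exact: h12.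
Qed.

Lemma dominated_oo t h c C : measurable_fun `]0, t[ h -> measurable_fun `]0, t[ c ->
  (forall s, 0 < s -> s < t -> `|h s| <= c s) ->
  (\int[lam]_(s in `]0%R, t[) (c s)%:E <= C%:E)%E ->
  (\int[lam]_(s in `]0%R, t[) `|h s|%:E <= C%:E)%E.
Proof.
move=> mh mc hc cC; apply: le_trans cC; apply: ge0_le_integral => //.
- by apply/measurable_EFinP; exact: measurableT_comp.
- exact/measurable_EFinP.
- by move=> s /=; rewrite in_itv /= => /andP[s0 st]; rewrite lee_fin hc.
Qed.

Lemma Rintegral_cc_le t h c C : measurable_fun `]0, t[ h -> measurable_fun `]0, t[ c ->
  (forall s, 0 < s -> s < t -> `|h s| <= c s) ->
  (\int[lam]_(s in `]0%R, t[) (c s)%:E <= C%:E)%E ->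
  `|\int[lam]_(s in `[0, t]) h s| <= C.
Proof.
move=> mh mc hc cC; rewrite Rintegral_cc_oo//; apply: abs_Rintegral_le => //.
exact: dominated_oo cC.
Qed.

Lemma integral_oo_cst t (r : R) : 0 <= t ->
  (\int[lam]_(s in `]0%R, t[) r%:E = (r * t)%:E)%E.
Proof.
move=> t0; rewrite integral_cst//= lebesgue_measure_itv/= lte_fin.
case: ltP => [_|t1]; first by rewrite oppr0 adde0 EFinM.
by rewrite mule0 (_ : t = 0) ?mulr0//; apply/eqP; rewrite eq_le t0 t1.
Qed.

(** The final period on which t - s is too small for the Lipschitz bound in time of
    the kernel to be of use contributes no more than its length. *)
Lemma integral_tail t del : 0 <= del ->
  (\int[lam]_(s in `]0%R, t[) (\1_(`[t - del, +oo[) s)%:E <= del%:E)%E.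
Proof.
move=> d0; rewrite integral_indic//=.
apply: (@le_trans _ _ (lam `[t - del, t])).
  apply: le_measure; rewrite ?inE//.
  - by apply: measurableI; exact: measurable_itv.
  - move=> s /= []; rewrite !in_itv/= andbT => -> /andP[_ /ltW ->] //.
rewrite lebesgue_measure_itv/=; case: ifP => _; last by rewrite lee_fin.
by rewrite -EFinB lee_fin opprB addrC subrK.
Qed.

Lemma measurable_1Dpow (e : R) D : measurable_fun D (fun s : R => (1 + s) `^ e).
Proof.
apply: measurable_funTS; apply: (measurableT_comp (measurable_powR _)).
by apply: measurable_funD => //; exact: measurable_cst.
Qed.

Lemma integral_1Dpow (e t : R) : 0 < e -> 0 < t ->
  (\int[lam]_(s in `]0%R, t[) ((1 + s) `^ (e - 1))%:E <= ((1 + t) `^ e / e)%:E)%E.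
Proof.
move=> e0 t0.
rewrite -(@integral_itv_bndoo _ 0 t _ true false); last first.
  by apply/measurable_EFinP; exact: measurable_1Dpow.
have dP (r s : R) : 0 <= s -> is_derive s (1 : R) (fun s : R => (1 + s) `^ r)
    (r * (1 + s) `^ (r - 1)).
  move=> s0; have s1 : 0 < 1 + s by rewrite ltr_wpDr.
  have d1 : is_derive s (1 : R) (fun x : R => 1 + x) 1.
    by have := is_deriveD (is_derive_cst (1 : R) s 1) (is_derive_id s 1); rewrite add0r.
  have := @is_derive1_comp R (@powR R ^~ r) (fun x => 1 + x) s _ _
    (is_derive1_powR r s1) d1.
  by rewrite /GRing.scale/= mulr1.
pose F s : R := e^-1 * (1 + s) `^ e.
have dF (s : R) : 0 <= s -> is_derive s (1 : R) F ((1 + s) `^ (e - 1)).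
  move=> s0; have d3 := dP e s s0; rewrite /F; apply: is_derive_eq.
  by rewrite /GRing.scale/= mulrA mulVf ?mul1r// gt_eqF.
have diff_cont (h : R -> R) (s l : R) : is_derive s (1 : R) h l -> {for s, continuous h}.
  move=> dh; apply: differentiable_continuous; apply/derivable1_diffP.
  exact: (@ex_derive _ _ _ _ _ _ _ dh).
have cF (s : R) : 0 <= s -> {for s, continuous F} by move=> /dF; exact: diff_cont.
have cf (s : R) : 0 <= s -> {for s, continuous (fun s : R => (1 + s) `^ (e - 1))}.
  by move=> /(dP (e - 1)); exact: diff_cont.
rewrite (@continuous_FTC2 _ _ F 0 t)//.
- rewrite -EFinB lee_fin /F [leRHS]mulrC gerBl addr0 powR1 mulr1 invr_ge0 ltW//.
- apply: continuous_in_subspaceT => s; rewrite inE/= in_itv/= => /andP[s0 _].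
  exact: cf.
- split.
  + move=> s; rewrite in_itv/= => /andP[s0 _].
    exact: (@ex_derive _ _ _ _ _ _ _ (dF s (ltW s0))).
  + by apply: cvg_at_right_filter; exact: cF.
  + by apply: cvg_at_left_filter; apply: cF; exact: ltW.
- move=> s; rewrite in_itv/= => /andP[s0 _]; rewrite derive1E.
  exact: (@derive_val _ _ _ _ _ _ _ (dF s (ltW s0))).
Qed.

End time_integral.

Section bdd.
Context {R : realType} {n : nat}.
Implicit Types (f g : Rn R n -> R) (s t : R) (x y : Rn R n) (F : R -> Rn R n -> R).
Local Notation mu := (@lebesgue_Rn R n).
Local Notation lam := (@lebesgue_measure R).

(** * Simultaneous bounds in the supremum and the L1 norm *)

(** Bounds are pointwise rather than almost everywhere: functions built by
    Duhamel's formula satisfy them at every point, and suprema then need no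
    choice of representatives. *)
Definition bdd (c d : R) f := [/\ measurable_fun setT f,
  (forall x, `|f x| <= c) & (\int[mu]_x `|f x|%:E <= d%:E)%E].

Definition jmeas (f : R -> Rn R n -> R) :=
  measurable_fun setT (fun z : R * Rn R n => f z.1 z.2).

Lemma jmeas_space F s : jmeas F -> measurable_fun setT (F s).
Proof. by move=> jf; exact: (measurable_fun_pair2 s jf). Qed.

Lemma jmeas_time F x D : jmeas F -> measurable_fun D (fun s => F s x).
Proof. by move=> jf; apply: measurable_funTS; exact: (measurable_fun_pair1 x jf). Qed.

Lemma jmeas_comp F d (T : measurableType d) (a : T -> R) (X : T -> Rn R n) :
  jmeas F -> measurable_fun setT a -> measurable_fun setT X ->
  measurable_fun setT (fun z => F (a z) (X z)).
Proof.
move=> jF ma mX.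
apply: (measurableT_comp (f := fun z : R * Rn R n => F z.1 z.2)
  (g := fun z => (a z, X z)) jF).
by apply/measurable_fun_pairP; split.
Qed.

Lemma bddS c d c' d' f : c <= c' -> d <= d' -> bdd c d f -> bdd c' d' f.
Proof.
move=> cc dd [mf fc fd]; split => //; first by move=> x; exact: le_trans cc.
by apply: le_trans fd _; rewrite lee_fin.
Qed.

Lemma bdd_ge0 c d f : bdd c d f -> 0 <= c /\ 0 <= d.
Proof.
move=> [mf fc fd]; split; first exact: le_trans (fc point).
by rewrite -lee_fin; apply: le_trans fd; exact: integral_ge0.
Qed.

Lemma bdd_lin c d c' d' (a : R) f g : bdd c d f -> bdd c' d' g ->
  bdd (`|a| * c + c') (`|a| * d + d') (fun x => a * f x + g x).
Proof.
move=> [mf fc fd] [mg gc gd].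
have mh : measurable_fun setT (fun x => a * f x + g x).
  by apply: measurable_funD => //; exact: measurable_funM.
have le1 x : `|a * f x + g x| <= `|a| * `|f x| + `|g x|.
  by rewrite -normrM; exact: ler_normD.
split => // [x|].
  by apply: le_trans (le1 x) _; rewrite lerD// ler_wpM2l.
apply: (@le_trans _ _ (\int[mu]_x (`|a|%:E * `|f x|%:E + `|g x|%:E))%E).
  apply: ge0_le_integral => //.
  - by apply/measurable_EFinP/measurableT_comp.
  - by apply: emeasurable_funD; [apply: measurable_funeM|];
      apply/measurable_EFinP/measurableT_comp.
  - by move=> x _; rewrite -EFinM -EFinD lee_fin.
have mf' : measurable_fun setT (fun x => `|f x|%:E) by apply/measurable_EFinP/measurableT_comp.
have mg' : measurable_fun setT (fun x => `|g x|%:E) by apply/measurable_EFinP/measurableT_comp.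
rewrite ge0_integralD//; last exact: measurable_funeM.
rewrite ge0_integralZl// EFinD EFinM leeD//.
by rewrite lee_wpmul2l.
Qed.

Lemma bdd_heat c d t f : 0 < t -> bdd c d f -> bdd c d (heat t f).
Proof.
move=> t0 [mf fc fd]; split.
- exact: measurable_heat.
- by move=> x; exact: heat_sup.
- exact: le_trans (heat_L1 t0 mf) fd.
Qed.

(** Functions that satisfy the weighted pair of bounds at time s flow to
    functions that satisfy it at time t, at the cost of the constant 2^{n/2}.
    The class in which the system is solved is built on this property. *)
Lemma bdd_heat_weight s t a f : 0 <= s -> s < t ->
  bdd (a * (1 + s) `^ (- (n%:R / 2))) a f ->
  bdd (2 `^ (n%:R / 2) * a * (1 + t) `^ (- (n%:R / 2))) (2 `^ (n%:R / 2) * a)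
    (heat (t - s) f).
Proof.
move=> s0 st bf; have [_ a0] := bdd_ge0 bf; have [mf fc fd] := bf.
have ts : 0 < t - s by rewrite subr_gt0.
split; first exact: measurable_heat.
- by move=> x; exact: heat_weight.
- apply: le_trans (heat_L1 ts mf) _; apply: le_trans fd _; rewrite lee_fin.
  rewrite ler_peMl//.
  have := @ler_powR R 2 _ 0 (n%:R / 2); rewrite powRr0; apply; first by rewrite ler1n.
  by rewrite divr_ge0.
Qed.

Lemma bdd_heat_time a b c d f : 0 < a -> 0 < b -> bdd c d f ->
  bdd (2 * n%:R * (`|b - a| / b) * c) (2 * n%:R * (`|b - a| / b) * d)
    (fun x => heat b f x - heat a f x).
Proof.
move=> a0 b0 [mf fc fd]; split.
- by apply: measurable_funB; exact: measurable_heat.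
- by move=> x; exact: heat_time_sup.
- apply: le_trans (heat_time_L1 a0 b0 mf fc) _; rewrite [leRHS]EFinM lee_wpmul2l//.
  by rewrite lee_fin !mulr_ge0// invr_ge0 ltW.
Qed.

(** Minkowski's inequality for an integral over time. *)
Lemma bdd_time_integral (H : R -> Rn R n -> R) t (c d : R -> R) C D :
  jmeas H -> (forall s, 0 < s -> s < t -> bdd (c s) (d s) (H s)) ->
  measurable_fun `]0, t[ c -> measurable_fun `]0, t[ d ->
  (\int[lam]_(s in `]0%R, t[) (c s)%:E <= C%:E)%E ->
  (\int[lam]_(s in `]0%R, t[) (d s)%:E <= D%:E)%E ->
  bdd C D (fun x => \int[lam]_(s in `[0, t]) H s x).
Proof.
move=> jH bH mc md cC dD.
(* H s is controlled for 0 < s < t only. *)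
pose G x s := (if (0 < s) && (s < t) then H s x else 0).
have mG : measurable_fun setT (fun z : Rn R n * R => G z.1 z.2).
  apply: measurable_fun_ifT.
  - by apply: measurable_and; apply: measurable_fun_ltr => //; exact: measurable_cst.
  - by apply: jmeas_comp.
  - exact: measurable_cst.
have GE x : \int[lam]_(s in `[0, t]) H s x = \int[lam]_s G x s.
  rewrite Rintegral_cc_oo; last exact: jmeas_time.
  rewrite Rintegral_mkcond; apply: eq_Rintegral => s _.
  by rewrite /G patchE mem_setE in_itv.
split.
- under eq_fun do rewrite GE; exact: measurable_Rintegral.
- move=> x; apply: Rintegral_cc_le cC => //; first exact: jmeas_time.
  by move=> s s0 st; have [_ h _] := bH s s0 st.
under eq_integral => x _ do rewrite GE.
have mGe : measurable_fun setT (fun z : Rn R n * R => `|G z.1 z.2|%:E).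
  by apply/measurable_EFinP/measurableT_comp.
apply: (@le_trans _ _ (\int[mu]_x \int[lam]_s `|G x s|%:E)%E).
  apply: ge0_le_integral => //.
  - by apply/measurable_EFinP/measurableT_comp => //; exact: measurable_Rintegral.
  - exact: (@measurable_fun_fubini_tonelli_F _ _ _ _ _ lam _ mGe).
  - move=> x _; apply: le_abs_Rintegral => //.
    exact: (measurable_fun_pair2 x mG).
apply: (@le_trans _ _ (\int[lam]_s \int[mu]_x `|G x s|%:E)%E).
  rewrite le_eqVlt; apply/orP; left; apply/eqP.
  exact: (@fubini_tonelli _ _ _ _ _ mu lam _ mGe).
apply: le_trans dD; rewrite [leRHS]integral_mkcond.
apply: ge0_le_integral => //.
- by move=> s _; exact: integral_ge0.
- exact: (@measurable_fun_fubini_tonelli_G _ _ _ _ _ mu _ mGe).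
- by apply/(measurable_restrictT _ _).1 => //; exact/measurable_EFinP.
move=> s _; rewrite patchE mem_setE in_itv/= /G.
case: ifP => [/andP[s0 st]|_]; first by have [] := bH s s0 st.
by under eq_integral do rewrite normr0; rewrite integral0.
Qed.

Lemma jmeas_heat t (f : R -> Rn R n -> R) : jmeas f ->
  jmeas (fun s => heat (t - s) (f s)).
Proof.
move=> jf; apply: (measurable_heat_param (a := fun z : R * Rn R n => t - z.1)
  (f := fun z => f z.1) (X := snd)) => //.
- by apply: measurable_funB => //; exact: measurable_cst.
- by apply: jmeas_comp => //; exact: measurableT_comp.
Qed.

Definition duhamel (f : R -> Rn R n -> R) t x : R :=
  \int[lam]_(s in `[0, t]) heat (t - s) (f s) x.

Lemma jmeas_duhamel (f : R -> Rn R n -> R) : jmeas f -> jmeas (duhamel f).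
Proof.
move=> jf.
pose G (z : R * Rn R n) s :=
  (if (0 < s) && (s < z.1) then heat (z.1 - s) (f s) z.2 else 0).
rewrite /jmeas (_ : (fun z => _) = (fun z => \int[lam]_s G z s)); last first.
  apply/funext => -[t x]; rewrite /duhamel Rintegral_cc_oo; last first.
    by apply: (@jmeas_time (fun s => heat (t - s) (f s))); exact: jmeas_heat.
  rewrite Rintegral_mkcond; apply: eq_Rintegral => s _.
  by rewrite /G patchE mem_setE in_itv.
apply: measurable_Rintegral; apply: measurable_fun_ifT.
- apply: measurable_and; apply: measurable_fun_ltr => //.
  by apply: measurableT_comp.
- apply: (measurable_heat_param (a := fun z : (R * Rn R n) * R => z.1.1 - z.2)
    (f := fun z => f z.2) (X := fun z => z.1.2)).
  + by apply: measurable_funB => //; exact: measurableT_comp.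
  + by apply: jmeas_comp => //; exact: measurableT_comp.
  + exact: measurableT_comp.
- exact: measurable_cst.
Qed.

End bdd.

(** * Lipschitz bounds and contraction *)
Section power.
Context {R : realType}.
Implicit Types (a b p M : R).

Lemma powR_pred a p : 0 <= a -> 1 <= p -> a `^ p = a `^ (p - 1) * a.
Proof.
move=> a0 p1; have [->|aN0] := eqVneq a 0.
  by rewrite mulr0 powR0// gt_eqF// (lt_le_trans ltr01).
by rewrite -[X in _ * X]powRr1// -powRD ?subrK// aN0 implybT.
Qed.

(** A Lipschitz constant of |a|^p on [-M, M]; the sharp factor is p, the integer
    above it is what Bernoulli's inequality gives. *)
Definition powR_lip p M : R := (Num.truncn p).+1%:R * M `^ (p - 1).

Lemma powR_lip_ge0 p M : 0 <= powR_lip p M.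
Proof. by rewrite mulr_ge0// powR_ge0. Qed.

(** For |b| <= |a| write |b| = th |a| and estimate 1 - th^p by Bernoulli. *)
Lemma powR_lipP p M a b : 1 <= p -> `|a| <= M -> `|b| <= M ->
  `| `|a| `^ p - `|b| `^ p | <= powR_lip p M * `|a - b|.
Proof.
move=> p1; have p0 : 0 < p by exact: lt_le_trans p1.
wlog ab : a b / `|b| <= `|a|.
  move=> H aM bM; have [|/ltW] := leP `|b| `|a|; first by move=> h; exact: H.
  by move=> h; rewrite distrC [`|a - b|]distrC; exact: H.
move=> aM bM; have [a0|a0] := eqVneq `|a| 0.
  have b0 : `|b| = 0 by apply/eqP; rewrite eq_le normr_ge0 andbT -a0.
  by rewrite a0 b0 subrr normr0 mulr_ge0// powR_lip_ge0.
have ap : 0 < `|a| by rewrite lt_neqAle eq_sym a0 normr_ge0.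
have th0 : 0 <= `|b| / `|a| by rewrite divr_ge0.
have th1 : `|b| / `|a| <= 1 by rewrite ler_pdivrMr// mul1r.
have := bernoulli_powR th0 th1 (ltW p0) (ltW (truncnS_gt p)).
move=> B.
have -> : `|b| `^ p = `|a| `^ p * (`|b| / `|a|) `^ p.
  by rewrite -powRM// mulrCA mulfV// mulr1.
rewrite -[X in `|X - _|]mulr1 -mulrBr ger0_norm; last first.
  rewrite mulr_ge0 ?powR_ge0// subr_ge0.
  have := @ge0_ler_powR R p (ltW p0) (`|b| / `|a|) 1; rewrite powR1; apply => //.
  by rewrite nnegrE.
apply: (@le_trans _ _ (`|a| `^ p * ((Num.truncn p).+1%:R * (1 - `|b| / `|a|)))).
  by rewrite ler_wpM2l ?powR_ge0//; lra.
rewrite powR_pred// /powR_lip.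
have -> : `|a| `^ (p - 1) * `|a| * ((Num.truncn p).+1%:R * (1 - `|b| / `|a|)) =
   (Num.truncn p).+1%:R * `|a| `^ (p - 1) * (`|a| - `|b|) by field.
apply: ler_pM; rewrite ?mulr_ge0 ?powR_ge0 ?subr_ge0//.
  rewrite ler_wpM2l//; apply: ge0_ler_powR; rewrite ?subr_ge0 ?nnegrE//.
  exact: le_trans aM.
exact: lerB_dist.
Qed.

Lemma cvg_half_pow (C : R) : (fun m => C / 2 ^+ m) @ \oo --> 0.
Proof.
have -> : (fun m => C / 2 ^+ m) = fun m => C * (2^-1) ^+ m.
  by apply/funext => m; rewrite exprVn.
rewrite -[X in _ --> X](mulr0 C); apply: cvgM; first exact: cvg_cst.
by apply: cvg_expr; rewrite ger0_norm// invf_lt1// ltr1n.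
Qed.

(** Adding or subtracting the bound 2 G / 2^m for the remainder makes x monotone,
    so that the limit lies between the two resulting sequences. *)
Lemma geometric_cvg (x : nat -> R) (G : R) :
  (forall m, `|x m.+1 - x m| <= G / 2 ^+ m) ->
  exists2 l, x @ \oo --> l & forall m, `|l - x m| <= 2 * G / 2 ^+ m.
Proof.
move=> xG; have G0 : 0 <= G by have := le_trans (normr_ge0 _) (xG 0%N); rewrite expr0 divr1.
pose c m : R := 2 * G / 2 ^+ m.
have cS m : c m.+1 = G / 2 ^+ m.
  by rewrite /c exprS invfM -mulrA [G * _]mulrC !mulrA mulfV// mul1r mulrC.
have c2 m : c m = 2 * (G / 2 ^+ m) by rewrite /c mulrA.
have c0 m : 0 <= c m by rewrite c2 mulr_ge0// divr_ge0// exprn_ge0.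
have ccvg : c @ \oo --> 0 by exact: cvg_half_pow.
pose y m := x m + c m; pose z m := x m - c m.
have niy : nonincreasing_seq y.
  apply/nonincreasing_seqP => m; rewrite /y cS c2.
  by have := xG m; rewrite ler_norml => /andP[_]; lra.
have ndz : nondecreasing_seq z.
  apply/nondecreasing_seqP => m; rewrite /z cS c2.
  by have := xG m; rewrite ler_norml => /andP[+ _]; lra.
have zy i j : z i <= y j.
  apply: (@le_trans _ _ (z (maxn i j))); first by apply: ndz; exact: leq_maxl.
  apply: (@le_trans _ _ (y (maxn i j))); last by apply: niy; exact: leq_maxr.
  by rewrite /z /y; have := c0 (maxn i j); lra.
have ycvg : cvgn y.
  apply: nonincreasing_is_cvgn => //; exists (z 0%N) => _ [m _ <-]; exact: zy.
exists (limn y).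
  have -> : x = fun m => y m - c m by apply/funext => m; rewrite /y addrK.
  rewrite -[X in _ --> X]subr0; exact: cvgB.
move=> m; rewrite -/(c m) ler_norml; apply/andP; split.
  rewrite lerBrDr addrC -/(z m); apply: limr_ge => //.
  by apply: nearW => j; exact: zy.
rewrite lerBlDr addrC -/(y m); apply: limr_le => //.
by exists m => // j /= mj; exact: niy.
Qed.

End power.

(** The gain of a factor 1/2 common to existence and uniqueness: integrating
    L (1 + s)^e over ]0, t[ gives at most (1 + t)^e L (1 + t) / (e + 1), and the
    exponent e = 2 L (1 + T) makes the last quotient at most 1/2. *)
Lemma contraction_integral (R : realType) (L B T t c : R) (h1 h2 : R -> R) :
  0 <= L -> 0 <= B -> 0 < t -> t <= T ->
  measurable_fun `]0, t[ h1 -> measurable_fun `]0, t[ h2 ->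
  (forall s, 0 < s -> s < t -> `|h1 s| <= c) ->
  (forall s, 0 < s -> s < t -> `|h2 s| <= c) ->
  (forall s, 0 < s -> s < t ->
    `|h1 s - h2 s| <= L * B * (1 + s) `^ (2 * L * (1 + T))) ->
  `|\int[lebesgue_measure]_(s in `[0, t]) h1 s -
    \int[lebesgue_measure]_(s in `[0, t]) h2 s|
  <= B / 2 * (1 + t) `^ (2 * L * (1 + T)).
Proof.
move=> L0 B0 t0 tT mh1 mh2 h1c h2c h12; set e := 2 * L * (1 + T).
have e_ge0 : 0 <= e by rewrite !mulr_ge0// addr_ge0// (le_trans (ltW t0)).
have mI (h : R -> R) : measurable_fun `]0, t[ h ->
    (forall s, 0 < s -> s < t -> `|h s| <= c) ->
    (@lebesgue_measure R).-integrable `]0, t[ (EFin \o h).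
  move=> mh hc; apply: (bounded_integrable (c := c * t)) => //.
  apply: (dominated_oo (c := fun=> c)) => //; last by rewrite integral_oo_cst// ltW.
rewrite !Rintegral_cc_oo// -RintegralB//; [|exact: mI|exact: mI].
rewrite -Rintegral_cc_oo; last exact: measurable_funB.
have e1 : 0 < e + 1 by rewrite ltr_wpDl.
have tt : 0 < 1 + t by rewrite addr_gt0.
apply: (Rintegral_cc_le (c := fun s => (L * B) * (1 + s) `^ (e + 1 - 1))).
- exact: measurable_funB.
- by apply: measurable_funM => //; exact: measurable_1Dpow.
- by move=> s s0 st; rewrite addrK; exact: h12.
under eq_integral do rewrite EFinM.
rewrite ge0_integralZl//; first last.
- by rewrite lee_fin mulr_ge0.
- by move=> s _; rewrite lee_fin powR_ge0.
- by apply/measurable_EFinP; exact: measurable_1Dpow.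
apply: le_trans (lee_wpmul2l _ (integral_1Dpow e1 t0)) _; first by rewrite lee_fin mulr_ge0.
rewrite -EFinM lee_fin (@powR_pred _ (1 + t) (e + 1)) ?lerDr ?(ltW tt)// addrK.
rewrite [leLHS](_ : _ = B * (1 + t) `^ e * (L * (1 + t) / (e + 1))); last by field; rewrite gt_eqF.
rewrite [leRHS](_ : _ = B * (1 + t) `^ e * 2^-1); last by field.
rewrite ler_wpM2l ?mulr_ge0 ?powR_ge0// ler_pdivrMr// mulrDr mulr1 /e.
have : L * (1 + t) <= L * (1 + T) by rewrite ler_wpM2l// lerD2l.
by lra.
Qed.

Lemma limn_einf_le_cst (R : realType) (x : nat -> \bar R) (c : \bar R) :
  (forall m, x m <= c)%E -> (limn_einf x <= c)%E.
Proof.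
move=> xc; rewrite limn_einf_lim; apply: lime_le; first exact: is_cvg_einfs.
by apply: nearW => m; apply: le_trans (xc m); apply: ereal_inf_lbound; exists m => /=.
Qed.

(** * Picard iteration below a majorant *)
Section picard.
Context {R : realType} {n k : nat}.
Implicit Types (u v : R -> 'I_k -> Rn R n -> R) (t s : R).
Local Notation mu := (@lebesgue_Rn R n).
Local Notation lam := (@lebesgue_measure R).
Local Notation w t := ((1 + t) `^ (- (n%:R / 2))).

(** One factor |f| is kept for the integral, the others are bounded. *)
Lemma bdd_pow c d p (f : Rn R n -> R) : 1 <= p -> bdd c d f ->
  bdd (c `^ p) (c `^ (p - 1) * d) (fun x => `|f x| `^ p).
Proof.
move=> p1 bf; have [c0 d0] := bdd_ge0 bf; have [mf fc fd] := bf.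
have mp : measurable_fun setT (fun x => `|f x| `^ p).
  by apply: (measurableT_comp (measurable_powR p)); exact: measurableT_comp.
split => //.
  move=> x; rewrite ger0_norm ?powR_ge0//.
  by apply: ge0_ler_powR; rewrite ?nnegrE// (le_trans ler01).
apply: (@le_trans _ _ (\int[mu]_x ((c `^ (p - 1))%:E * `|f x|%:E))%E).
  apply: ge0_le_integral => //.
  - by apply/measurable_EFinP/measurableT_comp.
  - by apply: measurable_funeM; apply/measurable_EFinP/measurableT_comp.
  - move=> x _; rewrite -EFinM lee_fin ger0_norm ?powR_ge0// powR_pred//.
    rewrite ler_wpM2r//; apply: ge0_ler_powR; rewrite ?nnegrE ?subr_ge0//.
rewrite ge0_integralZl//.
- by rewrite EFinM lee_wpmul2l// lee_fin powR_ge0.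
- by apply/measurable_EFinP/measurableT_comp.
- by rewrite lee_fin powR_ge0.
Qed.

Variables (p : 'I_k -> R) (u0 : 'I_k -> Rn R n -> R) (T N0 : R).
Hypotheses (p1 : forall j, 1 <= p j) (bu0 : forall j, bdd N0 N0 (u0 j)).
Let K : R := 2 `^ (n%:R / 2).

Definition source u j : R -> Rn R n -> R :=
  fun s y => `|u s (ordS j) y| `^ p j.

Definition jmeas_sys u := forall j, jmeas (fun t => u t j).

Lemma jmeas_source u j : jmeas_sys u -> jmeas (source u j).
Proof.
move=> ju; apply: (measurableT_comp (measurable_powR (p j))).
by apply: measurableT_comp => //; exact: (ju (ordS j)).
Qed.

(** The value 0 outside ]0, T[, where nothing is known about u, makes the
    iterates converge at every (t, x), so that their limit is jointly
    measurable. *)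
Definition picard u t j x : R :=
  if (0 < t) && (t < T) then heat t (u0 j) x + duhamel (source u j) t x else 0.

Lemma picardE u t j : 0 < t -> t < T ->
  picard u t j = fun x => heat t (u0 j) x + duhamel (source u j) t x.
Proof. by move=> t0 tT; apply/funext => x; rewrite /picard t0 tT. Qed.

Lemma jmeas_picard u : jmeas_sys u -> jmeas_sys (picard u).
Proof.
move=> ju j; apply: measurable_fun_ifT.
- by apply: measurable_and; apply: measurable_fun_ltr => //; exact: measurable_cst.
- apply: measurable_funD.
    apply: (measurable_heat_param (a := fst) (f := fun=> u0 j) (X := snd)) => //.
    by apply: measurableT_comp => //; case: (bu0 j).
  by apply: jmeas_duhamel; exact: jmeas_source.
- exact: measurable_cst.
Qed.

(* a j is a majorant for the component j, g j the resulting bound for the source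
   term of the equation j, and G j a bound for the integral of g j; the
   hypothesis majorant says that Duhamel's formula reproduces a. *)
Variables (a g G : 'I_k -> R -> R) (D : R).
Hypothesis a_ge0 : forall j t, 0 < t -> t < T -> 0 <= a j t.
Hypothesis a_le : forall j t, 0 < t -> t < T -> a j t <= D.
Hypothesis mg : forall j, measurable_fun setT (g j).
Hypothesis pow_le : forall j t, 0 < t -> t < T ->
  a (ordS j) t `^ p j * w t `^ (p j - 1) <= g j t.
Hypothesis int_g : forall j t, 0 < t -> t < T ->
  (\int[lam]_(s in `]0%R, t[) (g j s)%:E <= (G j t)%:E)%E.
Hypothesis majorant : forall j t, 0 < t -> t < T -> K * N0 + K * G j t <= a j t.

Definition admissible u := jmeas_sys u /\
  forall t j, 0 < t -> t < T -> bdd (a j t * w t) (a j t) (u t j).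

Lemma source_bdd u j s : admissible u -> 0 < s -> s < T ->
  bdd (g j s * w s) (g j s) (source u j s).
Proof.
move=> [ju bu] s0 sT; have /bdd_pow := bu s (ordS j) s0 sT => /(_ _ (p1 j)).
have w0 : 0 <= w s by exact: powR_ge0.
have as0 : 0 <= a (ordS j) s by exact: a_ge0.
rewrite !powRM//; apply: bddS.
  by rewrite [w s `^ _]powR_pred// mulrA ler_wpM2r//; exact: pow_le.
rewrite mulrAC -powR_pred//; exact: pow_le.
Qed.

Lemma picard_admissible u : admissible u -> admissible (picard u).
Proof.
move=> au; have [ju bu] := au; split; first exact: jmeas_picard.
move=> t j t0 tT; rewrite picardE//.
have w0 : 0 <= w t by exact: powR_ge0.
have K0 : 0 <= K by exact: powR_ge0.
have b0 : bdd (K * N0 * w t) (K * N0) (heat t (u0 j)).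
  have := @bdd_heat_weight R n 0 t N0 (u0 j) (lexx _) t0.
  by rewrite subr0 addr0 powR1 mulr1; apply.
have b1 : bdd (K * G j t * w t) (K * G j t) (duhamel (source u j) t).
  have int_gZ (r : R) : 0 <= r ->
      (\int[lam]_(s in `]0%R, t[) (r * g j s)%:E <= (r * G j t)%:E)%E.
    move=> r0; under eq_integral do rewrite EFinM.
    rewrite ge0_integralZl//.
    - by rewrite EFinM lee_wpmul2l// int_g.
    - by apply/measurable_EFinP; apply: measurable_funTS; exact: mg.
    - move=> s /=; rewrite in_itv/= => /andP[s0 st]; have sT := lt_trans st tT.
      by rewrite lee_fin; have [_] := bdd_ge0 (source_bdd j au s0 sT).
  apply: (@bdd_time_integral R n (fun s => heat (t - s) (source u j s)) t
    (fun s => (K * w t) * g j s) (fun s => K * g j s)).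
  - by apply: jmeas_heat; exact: jmeas_source.
  - move=> s s0 st; have sT := lt_trans st tT.
    by have := bdd_heat_weight (ltW s0) st (source_bdd j au s0 sT); rewrite mulrAC.
  - by apply: measurable_funTS; apply: measurable_funM => //; exact: measurable_cst.
  - by apply: measurable_funTS; apply: measurable_funM => //; exact: measurable_cst.
  - by rewrite mulrAC; apply: int_gZ; rewrite mulr_ge0.
  - exact: int_gZ.
have := bdd_lin 1 b0 b1; rewrite normr1 !mul1r.
under eq_fun do rewrite mul1r.
apply: bddS; last exact: majorant.
by rewrite -mulrDl ler_wpM2r//; exact: majorant.
Qed.

Lemma admissible_le u t j x : admissible u -> 0 < t -> t < T -> `|u t j x| <= D.
Proof.
move=> [_ bu] t0 tT; have [_ h _] := bu t j t0 tT.
apply: le_trans (h x) _; apply: le_trans (a_le j t0 tT).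
rewrite ler_piMr ?a_ge0//.
have := @le_powRN R 1 (1 + t) (n%:R / 2); rewrite powR1; apply => //.
by rewrite lerDl ltW.
Qed.

Let L : R := \sum_j powR_lip (p j) D.
Let e : R := 2 * L * (1 + T).

Let L_ge0 : 0 <= L. Proof. by apply: sumr_ge0 => j _; exact: powR_lip_ge0. Qed.

Hypothesis T0 : 0 < T.

Let e_ge0 : 0 <= e. Proof. by rewrite !mulr_ge0// addr_ge0// ltW. Qed.

Lemma source_lip u v j s x : admissible u -> admissible v -> 0 < s -> s < T ->
  `|source u j s x - source v j s x| <= L * `|u s (ordS j) x - v s (ordS j) x|.
Proof.
move=> au av s0 sT; apply: le_trans (powR_lipP (p1 j) _ _) _.
- exact: admissible_le.
- exact: admissible_le.
rewrite ler_wpM2r// /L (bigD1 j)//= lerDl.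
by apply: sumr_ge0 => i _; exact: powR_lip_ge0.
Qed.

Lemma picard_contraction u v B : admissible u -> admissible v ->
  (forall t j x, 0 < t -> t < T -> `|u t j x - v t j x| <= B * (1 + t) `^ e) ->
  forall t j x, 0 < t -> t < T ->
    `|picard u t j x - picard v t j x| <= B / 2 * (1 + t) `^ e.
Proof.
move=> au av uv t j x t0 tT; rewrite !picardE//.
have [ju bu] := au; have [jv bv] := av.
have B0 : 0 <= B.
  have := le_trans (normr_ge0 _) (uv t j x t0 tT).
  by rewrite pmulr_lge0// powR_gt0// ltr_wpDr// ltW.
rewrite opprD addrACA subrr add0r /duhamel.
have jhu := jmeas_heat t (jmeas_source j ju).
have jhv := jmeas_heat t (jmeas_source j jv).
have bsup (r : R -> 'I_k -> Rn R n -> R) s y : admissible r -> 0 < s -> s < t ->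
    `|source r j s y| <= g j s * w s.
  by move=> ar s0 st; have [] := source_bdd j ar s0 (lt_trans st tT).
have mB r s : admissible r -> 0 < s -> s < t ->
    `|heat (t - s) (source r j s) x| <= D `^ p j.
  move=> ar s0 st; have [jr br] := ar; apply: heat_sup; first by rewrite subr_gt0.
    exact: jmeas_space (jmeas_source j jr).
  move=> y; rewrite ger0_norm ?powR_ge0//; apply: ge0_ler_powR.
  - exact: le_trans (p1 j).
  - by rewrite nnegrE.
  - rewrite nnegrE; apply: le_trans (a_le j t0 tT); exact: a_ge0.
  - exact: admissible_le ar s0 (lt_trans st tT).
apply: (@contraction_integral _ L B T t (D `^ p j)) => //.
- exact: ltW.
- exact: (jmeas_time x jhu).
- exact: (jmeas_time x jhv).
- by move=> s s0 st; exact: mB.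
- by move=> s s0 st; exact: mB.
move=> s s0 st; have sT := lt_trans st tT; have ts : 0 < t - s by rewrite subr_gt0.
rewrite -(heatB x ts (jmeas_space s (jmeas_source j ju)) (jmeas_space s (jmeas_source j jv))
  (c := g j s * w s)); [|by move=> y; exact: bsup|by move=> y; exact: bsup].
apply: heat_sup => //.
  by apply: measurable_funB; exact: jmeas_space (jmeas_source j _).
move=> y; apply: le_trans (source_lip _ _ au av s0 sT) _.
by rewrite -mulrA ler_wpM2l// uv.
Qed.

Let U m := iter m picard (fun _ _ _ => 0).

Let U_adm m : admissible (U m).
Proof.
elim: m => [|m IH]; last exact: picard_admissible.
split; first by move=> j; exact: measurable_cst.
move=> t j t0 tT; have at0 := a_ge0 j t0 tT.
rewrite /U/=; split; first exact: measurable_cst.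
  by move=> x; rewrite normr0 mulr_ge0// powR_ge0.
by under eq_integral do rewrite normr0; rewrite integral0 lee_fin.
Qed.

Let tau_ge1 t : 0 < t -> 1 <= (1 + t) `^ e.
Proof.
move=> t0; have := @ler_powR R (1 + t) _ 0 e; rewrite powRr0; apply => //.
by rewrite lerDl ltW.
Qed.

Let U_diff m t j x : 0 < t -> t < T ->
  `|U m.+1 t j x - U m t j x| <= D / 2 ^+ m * (1 + t) `^ e.
Proof.
elim: m t j x => [|m IH] t j x t0 tT.
  rewrite expr0 divr1 subr0; apply: le_trans (admissible_le _ _ (U_adm 1) t0 tT) _.
  rewrite ler_peMr ?tau_ge1//; apply: le_trans (a_le j t0 tT); exact: a_ge0.
rewrite exprSr invfM mulrA.
apply: (picard_contraction (U_adm m.+1) (U_adm m) _ j x t0 tT) => s i y s0 sT.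
exact: IH.
Qed.

(** The sequence of iterates is pointwise geometric, uniformly up to the weight
    (1 + t)^e.  The pointwise bounds pass to the limit, the L1 bounds pass to it
    by Fatou's lemma, and the contraction property identifies the limit as a
    fixed point. *)
Lemma picard_exists : exists2 u, admissible u &
  forall t j x, 0 < t -> t < T -> u t j x =
    heat t (u0 j) x + duhamel (source u j) t x.
Proof.
have /choice[u hu] : forall z : R * 'I_k * Rn R n, exists l : R,
    (fun m => U m z.1.1 z.1.2 z.2) @ \oo --> l /\
    (0 < z.1.1 -> z.1.1 < T -> forall m,
      `|l - U m z.1.1 z.1.2 z.2| <= 2 * D / 2 ^+ m * (1 + z.1.1) `^ e).
  move=> [[t j] x] /=; have [/andP[t0 tT]|ntT] := boolP ((0 < t) && (t < T)).
    have [|l lc lU] := @geometric_cvg R (fun m => U m t j x) (D * (1 + t) `^ e).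
      by move=> m; rewrite mulrAC; exact: U_diff.
    by exists l; split=> // _ _ m; apply: le_trans (lU m) _; rewrite !mulrA mulrAC.
  exists 0; split; last by move=> t0 tT; rewrite t0 tT in ntT.
  rewrite (_ : (fun m => _) = cst 0); first exact: cvg_cst.
  by apply/funext => -[|m]//=; rewrite /picard (negbTE ntT).
pose u' t j x := u (t, j, x).
have ucvg t j x : (fun m => U m t j x) @ \oo --> u' t j x by case: (hu (t, j, x)).
have ubd t j x m : 0 < t -> t < T ->
    `|u' t j x - U m t j x| <= 2 * D / 2 ^+ m * (1 + t) `^ e.
  by move=> t0 tT; case: (hu (t, j, x)) => _; exact.
have ju : jmeas_sys u'.
  move=> j; apply: (measurable_fun_cvg (h := fun m z => U m z.1 j z.2)).
    by move=> m; have [jm _] := U_adm m; exact: (jm j).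
  by move=> -[t x] _; exact: ucvg.
have au : admissible u'.
  split=> // t j t0 tT; split; first exact: jmeas_space (ju j).
    move=> x; have ncvg : (fun m => `|U m t j x|) @ \oo --> `|u' t j x|.
      exact: cvg_norm (ucvg t j x).
    rewrite -(cvg_lim (@norm_hausdorff _ _) ncvg); apply: limr_le.
      by apply/cvg_ex; exists `|u' t j x|.
    by apply: nearW => m; have [_ bm] := U_adm m; have [_ h _] := bm t j t0 tT.
  have mU m : measurable_fun setT (fun x => `|U m t j x|%:E).
    apply/measurable_EFinP; apply: measurableT_comp => //.
    by have [jm _] := U_adm m; exact: jmeas_space (jm j).
  have E x : `|u' t j x|%:E = limn_einf (fun m => `|U m t j x|%:E).
    have c : (fun m => `|U m t j x|%:E) @ \oo --> `|u' t j x|%:E.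
      by apply: cvg_EFin; [exact: nearW|exact: cvg_norm (ucvg t j x)].
    by rewrite (is_cvg_limn_einfE (cvgP _ c)) (cvg_lim _ c).
  under eq_integral do rewrite E.
  apply: le_trans (fatou _ measurableT mU _) _ => //.
  apply: limn_einf_le_cst => m.
  by have [_ bm] := U_adm m; have [] := bm t j t0 tT.
exists u' => // t j x t0 tT.
have Pu : picard u' t j x = heat t (u0 j) x + duhamel (source u' j) t x.
  by rewrite picardE.
rewrite -Pu.
have Pcvg : (fun m => U m.+1 t j x) @ \oo --> picard u' t j x.
  pose c m : R := D * (1 + t) `^ e / 2 ^+ m.
  have ccvg : c @ \oo --> 0 by exact: cvg_half_pow.
  have Pc m : `|picard u' t j x - U m.+1 t j x| <= c m.
    rewrite (_ : c m = 2 * D / 2 ^+ m / 2 * (1 + t) `^ e).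
      apply: (picard_contraction au (U_adm m) _ j x t0 tT) => s i y s0 sT.
      exact: ubd.
    by rewrite /c; field; rewrite ?expf_neq0.
  apply: (@squeeze_cvgr _ _ _ _ (fun m => picard u' t j x - c m)
      (fun m => picard u' t j x + c m)).
  - apply: nearW => m; have := Pc m; rewrite ler_norml => /andP[h1 h2].
    by apply/andP; split; lra.
  - by rewrite -[X in _ --> X]subr0; apply: cvgB => //; exact: cvg_cst.
  - by rewrite -[X in _ --> X]addr0; apply: cvgD => //; exact: cvg_cst.
have Ucvg' : (fun m => U m.+1 t j x) @ \oo --> u' t j x.
  by rewrite (cvg_shiftS (fun m => U m t j x)); exact: ucvg.
exact: (cvg_unique _ Ucvg' Pcvg).
Qed.

End picard.

(** * Regularity in time of Duhamel's integral *)
Section ereal_cvg0.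
Context {R : realType} {X : Type} (F : set_system X) {FF : Filter F}.

Lemma ecvg0 (f : X -> \bar R) : (forall x, 0 <= f x)%E ->
  (forall e : R, 0 < e -> \forall x \near F, (f x <= e%:E)%E) -> f @ F --> 0%E.
Proof.
move=> f0 fe; apply/fine_cvgP; split.
  have := fe 1 ltr01; apply: filterS => x fx.
  by rewrite ge0_fin_numE//; apply: le_lt_trans fx _; rewrite ltry.
apply/cvgrPdist_le => e e0; have := fe e e0; apply: filterS => x fx.
have fin : f x \is a fin_num.
  by rewrite ge0_fin_numE//; apply: le_lt_trans fx _; rewrite ltry.
by rewrite sub0r normrN ger0_norm ?fine_ge0// -lee_fin /= fineK.
Qed.

Lemma ecvg0_near (f : X -> \bar R) (e : R) : f @ F --> 0%E -> 0 < e ->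
  \forall x \near F, (f x <= e%:E)%E.
Proof.
move=> f0 e0; have e0' : (0 < e%:E)%E by rewrite lte_fin.
have := f0 _ (open_ereal_lt' e0'); rewrite nbhs_simpl /=.
by apply: filterS => x /ltW.
Qed.

End ereal_cvg0.

Section Lnorm_oo.
Context d (T : measurableType d) (R : realType) (mu : {measure set T -> \bar R}).

Lemma Lnorm_oo_le (f : T -> R) (c : R) : 0 <= c -> (forall x, `|f x| <= c) ->
  ('N[mu]_+oo[EFin \o f] <= c%:E)%E.
Proof.
move=> c0 fc; rewrite unlock; case: ifP => _; last by rewrite lee_fin.
by apply/ess_supP; apply: aeW => x /=; rewrite lee_fin.
Qed.

Lemma Lnorm_oo_ae (f : T -> R) :
  \forall x \ae mu, (`|f x|%:E <= 'N[mu]_+oo[EFin \o f])%E.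
Proof.
rewrite unlock; case: ifPn => mu0.
  exact: (ess_sup_ge mu (abse \o (EFin \o f))).
exists setT; split => //; apply/eqP.
by rewrite eq_le measure_ge0 andbT leNgt.
Qed.

End Lnorm_oo.

Section time_regularity.
Context {R : realType} {n k : nat}.
Implicit Types (u v : R -> 'I_k -> Rn R n -> R) (t s : R).
Local Notation mu := (@lebesgue_Rn R n).
Local Notation lam := (@lebesgue_measure R).

Lemma normLp_ge0 q (v : 'I_k -> Rn R n -> R) : (0 <= normLp q v)%E.
Proof. by apply: sume_ge0 => j _; exact: Lnorm_ge0. Qed.

Lemma normL1Linfty_ge0 (v : 'I_k -> Rn R n -> R) : (0 <= normL1Linfty v)%E.
Proof. by rewrite adde_ge0// normLp_ge0. Qed.

Lemma normLp_ge q (v : 'I_k -> Rn R n -> R) j :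
  ('N[mu]_q[EFin \o v j] <= normLp q v)%E.
Proof.
by rewrite /normLp (bigD1 j)//= leeDl// sume_ge0// => i _; exact: Lnorm_ge0.
Qed.

Lemma bdd_Lfun c d (f : Rn R n -> R) : bdd c d f ->
  f \in Lfun mu 1 /\ f \in Lfun mu +oo.
Proof.
move=> bf; have [c0 d0] := bdd_ge0 bf; have [mf fc fd] := bf.
split; rewrite inE; apply/andP; split; rewrite inE //= /finite_norm.
- by rewrite Lnorm1; apply: le_lt_trans fd _; rewrite ltry.
- by apply: le_lt_trans (Lnorm_oo_le _ c0 fc) _; rewrite ltry.
Qed.

Lemma bdd_normLp (v : 'I_k -> Rn R n -> R) c d : (forall j, bdd c d (v j)) ->
  (normLp 1 v <= (k%:R * d)%:E)%E /\ (normLp +oo v <= (k%:R * c)%:E)%E.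
Proof.
move=> bv; have sumc (r : R) : (\sum_(j < k) r%:E)%E = (k%:R * r)%:E.
  by rewrite sumEFin sumr_const card_ord mulr_natl.
split; rewrite /normLp -sumc; apply: lee_sum => j _.
- by rewrite Lnorm1; have [] := bv j.
- by have [c0 _] := bdd_ge0 (bv j); have [_ h _] := bv j; exact: Lnorm_oo_le.
Qed.

Lemma bdd_subC c d (f g : Rn R n -> R) : bdd c d (fun x => f x - g x) ->
  bdd c d (fun x => g x - f x).
Proof.
move=> [mf fc fd]; split.
- rewrite (_ : (fun x => _) = fun x => - (f x - g x)); first exact: measurableT_comp.
  by apply/funext => x; rewrite opprB.
- by move=> x; rewrite distrC.
- by under eq_integral do rewrite distrC.
Qed.

(** Moving the final time by h = t' - t changes the kernel e^{(t - s) Delta} by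
    at most 2 n h / (t' - s) in operator norm.  This is at most 2 n h^{1/2} if
    t' - s >= h^{1/2}; the remaining s form an interval of length h^{1/2}, on
    which the change is bounded. *)
Lemma duhamel_time (f : R -> Rn R n -> R) (T S t t' : R) :
  jmeas f -> (forall s, 0 < s -> s < T -> bdd S S (f s)) ->
  0 < t -> t < t' -> t' < T -> t' - t <= 1 ->
  let C := S * Num.sqrt (t' - t) * (2 * n%:R * T + 2 * n%:R + 1) in
  bdd C C (fun x => duhamel f t' x - duhamel f t x).
Proof.
move=> jf bf t0 tt' t'T h1 C; pose h := t' - t.
have h0 : 0 < h by rewrite subr_gt0.
have t'0 := lt_trans t0 tt'; have tT := lt_trans tt' t'T.
have S0 : 0 <= S by have [] := bdd_ge0 (bf t t0 tT).
(* extended by 0 to s >= t, so that both integrals run over [0, t'] *)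
pose g s x := if s < t then heat (t - s) (f s) x else 0.
have jg : jmeas g.
  apply: measurable_fun_ifT.
  - by apply: measurable_fun_ltr => //; exact: measurable_cst.
  - exact: jmeas_heat.
  - exact: measurable_cst.
have jh := jmeas_heat t' jf.
pose H s x := heat (t' - s) (f s) x - g s x.
have jH : jmeas H by exact: measurable_funB.
have bh s : 0 < s -> s < t' -> bdd S S (heat (t' - s) (f s)).
  move=> s0 st; apply: bdd_heat; first by rewrite subr_gt0.
  exact: bf s0 (lt_trans st t'T).
have bg s : 0 < s -> s < t' -> bdd S S (g s).
  move=> s0 st; rewrite /g; have [st0|ts] := ltP s t.
    apply: bdd_heat; first by rewrite subr_gt0.
    exact: bf s0 (lt_trans st t'T).
  split; first exact: measurable_cst.
    by move=> x; rewrite normr0.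
  by under eq_integral do rewrite normr0; rewrite integral0 lee_fin.
have E : (fun x => duhamel f t' x - duhamel f t x) =
    (fun x => \int[lam]_(s in `[0, t']) H s x).
  apply/funext => x; have mI (r : R -> Rn R n -> R) : jmeas r ->
      (forall s, 0 < s -> s < t' -> bdd S S (r s)) ->
      lam.-integrable `]0, t'[ (EFin \o (fun s => r s x)).
    move=> jr br; apply: (bounded_integrable (c := S * t')) => //; first exact: jmeas_time.
    apply: (dominated_oo (c := fun=> S)); last by rewrite integral_oo_cst// ltW.
    - exact: jmeas_time.
    - exact: measurable_cst.
    - by move=> s s0 st; have [_ hr _] := br s s0 st.
  rewrite [RHS]Rintegral_cc_oo; last exact: jmeas_time.
  rewrite RintegralB//; [|exact: (mI _ jh bh)|exact: (mI g jg bg)].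
  rewrite /duhamel Rintegral_cc_oo; last exact: (jmeas_time x jh).
  rewrite Rintegral_cc_oo; last exact: (jmeas_time x (jmeas_heat t jf)).
  congr (_ - _); rewrite [LHS]Rintegral_mkcond [RHS]Rintegral_mkcond.
  apply: eq_Rintegral => s _; rewrite !patchE !mem_setE !in_itv/= /g.
  have [st|ts] := ltP s t; last by rewrite andbF if_same.
  by rewrite (lt_trans st tt').
rewrite E.
pose q := Num.sqrt h; have q0 : 0 < q by rewrite sqrtr_gt0.
have qq : h = q ^+ 2 by rewrite sqr_sqrtr// ltW.
have q1 : q <= 1 by rewrite -sqrtr1 ler_wsqrtr.
have hq : h <= q by rewrite qq expr2 ger_pMl.
(* The first summand is for t' - s >= q, the second one for the other s. *)
pose c s := 2 * n%:R * S * q + (2 * n%:R + 1) * S * \1_(`[t' - q, +oo[) s.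
have mc : measurable_fun `]0, t'[ c.
  apply: measurable_funTS; apply: measurable_funD; first exact: measurable_cst.
  by apply: measurable_funM; [exact: measurable_cst|exact: measurable_indic].
have cC : (\int[lam]_(s in `]0%R, t'[) (c s)%:E <= C%:E)%E.
  under eq_integral do rewrite EFinD.
  rewrite ge0_integralD//; first last.
  - apply/measurable_EFinP; apply: measurable_funTS.
    by apply: measurable_funM; [exact: measurable_cst|exact: measurable_indic].
  - by move=> s _; rewrite lee_fin !mulr_ge0// addr_ge0// mulr_ge0.
  - by move=> s _; rewrite lee_fin !mulr_ge0// ltW.
  rewrite integral_oo_cst ?(ltW t'0)//.
  under [X in (_ + X <= _)%E]eq_integral do rewrite EFinM.
  rewrite ge0_integralZl//; first last.
  - by rewrite lee_fin mulr_ge0// addr_ge0// mulr_ge0.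
  - by apply/measurable_EFinP; apply: measurable_funTS; exact: measurable_indic.
  apply: le_trans (leeD2l _ (lee_wpmul2l _ (integral_tail _ (ltW q0)))) _.
    by rewrite lee_fin mulr_ge0// addr_ge0// mulr_ge0.
  rewrite -EFinM -EFinD lee_fin /C -/h -/q.
  have -> : S * q * (2 * n%:R * T + 2 * n%:R + 1) =
    2 * n%:R * S * q * T + (2 * n%:R + 1) * S * q by ring.
  by rewrite lerD2r ler_wpM2l ?(ltW t'T)// !mulr_ge0// ltW.
apply: (bdd_time_integral jH _ mc mc cC cC) => s s0 st.
have tms : 0 < t' - s by rewrite subr_gt0.
have [st0|ts] := ltP s t; last first.
  rewrite /H /g ltNge ts/=; under eq_fun do rewrite subr0.
  have -> : c s = (2 * n%:R * S * q + (2 * n%:R + 1) * S).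
    rewrite /c indicE mem_set ?mulr1//= in_itv/= andbT.
    by rewrite lerBlDr -lerBlDl; apply: le_trans hq; rewrite /h lerB.
  suff key : S <= 2 * n%:R * S * q + (2 * n%:R + 1) * S.
    exact: (bddS key key (bh s s0 st)).
  have A : 0 <= n%:R * S * q by rewrite !mulr_ge0// ltW.
  have B : 0 <= n%:R * S by rewrite mulr_ge0.
  by lra.
have tms0 : 0 < t - s by rewrite subr_gt0.
have := bdd_heat_time tms0 tms (bf s s0 (lt_trans st t'T)).
rewrite /H /g st0; have -> : t' - s - (t - s) = h by rewrite /h; ring.
rewrite (ger0_norm (ltW h0)).
suff key : 2 * n%:R * (h / (t' - s)) * S <= c s by exact: bddS.
rewrite /c indicE; have [|nin] := boolP (s \in _).
  move=> _; rewrite mulr1.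
  have h2 : h / (t' - s) <= 1 by rewrite ler_pdivrMr// mul1r /h lerB// ltW.
  apply: (@le_trans _ _ (2 * n%:R * S)).
    by rewrite mulrAC ler_piMr// !mulr_ge0.
  have A : 0 <= n%:R * S * q by rewrite !mulr_ge0// ltW.
  by lra.
rewrite mulr0 addr0 [leRHS]mulrAC ler_wpM2r// ler_wpM2l ?mulr_ge0//.
have sq : q <= t' - s.
  move: nin; rewrite notin_setE/= in_itv/= andbT => /negP; rewrite -ltNge => /ltW.
  by lra.
by rewrite ler_pdivrMr// qq expr2 ler_wpM2l// ltW.
Qed.

End time_regularity.

(** * Solutions of Duhamel's formula are mild solutions *)
Section mild_existence.
Context {R : realType} {n k : nat}.
Implicit Types (u v : R -> 'I_k -> Rn R n -> R) (t s : R).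
Local Notation mu := (@lebesgue_Rn R n).
Local Notation lam := (@lebesgue_measure R).
Variables (p : 'I_k -> R) (u0 : 'I_k -> Rn R n -> R) (T N0 M : R).
Variable u : R -> 'I_k -> Rn R n -> R.
Hypotheses (p1 : forall j, 1 <= p j) (bu0 : forall j, bdd N0 N0 (u0 j)).
Hypotheses (T0 : 0 < T) (ju : jmeas_sys u).
Hypothesis bu : forall t j, 0 < t -> t < T -> bdd M M (u t j).
Hypothesis uE : forall t j x, 0 < t -> t < T ->
  u t j x = heat t (u0 j) x + duhamel (source p u j) t x.

Let S := \sum_j M `^ p j.

Let S_ge0 : 0 <= S. Proof. by apply: sumr_ge0 => j _; exact: powR_ge0. Qed.

Let bsource j s : 0 < s -> s < T -> bdd S S (source p u j s).
Proof.
move=> s0 sT; have := bdd_pow (p1 j) (bu (ordS j) s0 sT).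
have [M0 _] := bdd_ge0 (bu (ordS j) s0 sT).
rewrite -powR_pred//; apply: bddS; rewrite /S (bigD1 j)//= lerDl;
  by apply: sumr_ge0 => i _; exact: powR_ge0.
Qed.

Let N0_ge0 (j : 'I_k) : 0 <= N0. Proof. by have [] := bdd_ge0 (bu0 j). Qed.

Lemma mild_time_diff j s t : 0 < s -> s < t -> t < T -> t - s <= 1 ->
  let C := Num.sqrt (t - s) * (2 * n%:R * N0 / t + S * (2 * n%:R * T + 2 * n%:R + 1)) in
  bdd C C (fun x => u t j x - u s j x).
Proof.
move=> s0 st tT ts1 C; have t0 := lt_trans s0 st; have sT := lt_trans st tT.
have N00 := N0_ge0 j.
have b1 := bdd_heat_time s0 t0 (bu0 j).
have b2 := duhamel_time (jmeas_source p j ju) (bsource j) s0 st tT ts1.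
have := bdd_lin 1 b1 b2; rewrite normr1 !mul1r.
have -> : (fun x => 1 * (heat t (u0 j) x - heat s (u0 j) x) +
    (duhamel (source p u j) t x - duhamel (source p u j) s x)) =
    (fun x => u t j x - u s j x).
  by apply/funext => x; rewrite (uE j x t0 tT) (uE j x s0 sT) mul1r opprD addrACA.
have h0 : 0 < t - s by rewrite subr_gt0.
have q1 : Num.sqrt (t - s) <= 1 by rewrite -sqrtr1 ler_wsqrtr.
have hq : t - s <= Num.sqrt (t - s).
  by rewrite -[leLHS](sqr_sqrtr (ltW h0)) expr2 ger_pMl// sqrtr_gt0.
suff le1 : 2 * n%:R * (`|t - s| / t) * N0 +
    S * Num.sqrt (t - s) * (2 * n%:R * T + 2 * n%:R + 1) <= C by exact: bddS.
rewrite /C [leRHS]mulrDr lerD//; last by rewrite mulrA [S * _]mulrC.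
rewrite (ger0_norm (ltW h0)).
rewrite [leLHS](_ : _ = (t - s) * (2 * n%:R * N0 / t)); last by ring.
by rewrite ler_wpM2r// divr_ge0 ?mulr_ge0// ltW.
Qed.

Lemma mild_continuous t (e : R) : 0 < t -> t < T -> 0 < e ->
  exists2 del : R, 0 < del & forall s, `|s - t| < del ->
    [/\ 0 < s, s < T & forall j, bdd e e (fun x => u s j x - u t j x)].
Proof.
move=> t0 tT e0.
pose Q := 2 * n%:R * `|N0| / t + S * (2 * n%:R * T + 2 * n%:R + 1).
have Q0 : 0 <= Q.
  by rewrite addr_ge0 ?divr_ge0 ?mulr_ge0 ?addr_ge0 ?mulr_ge0// ltW.
pose r := e / (Q + 1); have r0 : 0 < r by rewrite divr_gt0// ltr_wpDl.
exists (Num.min (Num.min 1 t) (Num.min (T - t) (r ^+ 2))).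
  by rewrite !lt_min ltr01 t0 subr_gt0 tT exprn_gt0.
move=> s; rewrite !lt_min => /andP[/andP[s1 st] /andP[sT sr]].
have s0 : 0 < s by move: st; rewrite ltr_norml => /andP[+ _]; lra.
have sT' : s < T by move: sT; rewrite ltr_norml => /andP[_]; lra.
split=> // j.
have key a b : 0 < a -> a < b -> b < T -> t <= b -> b - a = `|s - t| ->
    bdd e e (fun x => u b j x - u a j x).
  move=> a0 ab bT tb ba; have ba1 : b - a <= 1 by rewrite ba ltW.
  have := mild_time_diff j a0 ab bT ba1.
  set C := _ * _; move=> bC; suff Ce : C <= e by exact: bddS bC.
  have CQ : C <= Num.sqrt (b - a) * Q.
    rewrite /C ler_wpM2l ?sqrtr_ge0// lerD2r (ger0_norm (N0_ge0 j)).
    by rewrite ler_wpM2l ?mulr_ge0 ?(N0_ge0 j)// lef_pV2 ?posrE// (lt_trans a0).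
  apply: le_trans CQ _; apply: (@le_trans _ _ (r * Q)).
    have rr : Num.sqrt (r ^+ 2) = r by rewrite sqrtr_sqr ger0_norm// ltW.
    by rewrite ler_wpM2r// -[leRHS]rr ler_wsqrtr// ba ltW.
  rewrite /r mulrAC ler_pdivrMr ?ltr_wpDl// ler_wpM2l// ?lerDl// ltW//.
have [st'|ts|->] := ltgtP s t.
- apply: bdd_subC; apply: key => //.
  by rewrite distrC ger0_norm// subr_ge0 ltW.
- by apply: key => //; [exact: ltW|rewrite ger0_norm// subr_ge0 ltW].
- split.
  + by apply: measurable_funB; exact: jmeas_space (ju j).
  + by move=> x; rewrite subrr normr0 ltW.
  + by under eq_integral do rewrite subrr normr0; rewrite integral0 lee_fin ltW.
Qed.

Lemma mild_initial (e : R) : 0 < e ->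
  exists2 del : R, 0 < del & forall s, 0 < s -> s < del ->
    s < T /\ forall j, (\int[mu]_x `|u s j x - u0 j x|%:E <= e%:E)%E.
Proof.
move=> e0; have e2 : 0 < e / 2 by rewrite divr_gt0.
have bm j : bmeas (u0 j) by have [m h _] := bu0 j; split=> //; exists N0.
have Iu0 j : mu.-integrable setT (EFin \o u0 j).
  by have [m _ h] := bu0 j; exact: bounded_integrable h.
have /fin_all_exists2[d d0 dP] j := heat_err_cvg0 (bm j) (Iu0 j) e2.
pose r := e / 2 / (S + 1); have r0 : 0 < r by rewrite divr_gt0// ltr_wpDl.
exists (Num.min (Num.min T r) (\big[Num.min/1]_j d j)).
  by rewrite !lt_min T0 r0 /=; apply/bigmin_gtP; split.
move=> s s0; rewrite !lt_min => /andP[/andP[sT sr] sd]; split=> // j.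
have sdj : s < d j by apply: lt_le_trans sd _; exact: bigmin_le.
have b1 : bdd (S * s) (S * s) (duhamel (source p u j) s).
  have cC : (\int[lam]_(r in `]0%R, s[) S%:E <= (S * s)%:E)%E.
    by rewrite integral_oo_cst// ltW.
  apply: (@bdd_time_integral _ _ (fun r => heat (s - r) (source p u j r)) s
    (fun=> S) (fun=> S) _ _ _ _ _ _ cC cC).
  - by apply: jmeas_heat; exact: jmeas_source.
  - move=> z z0 zs; apply: bdd_heat; first by rewrite subr_gt0.
    exact: bsource z0 (lt_trans zs sT).
  - exact: measurable_cst.
  - exact: measurable_cst.
have [mu0 _ _] := bu0 j; have [mD _ hD] := b1.
have mh : measurable_fun setT (fun x => heat s (u0 j) x - u0 j x).
  by apply: measurable_funB => //; exact: measurable_heat.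
apply: (@le_trans _ _ (\int[mu]_x (`|heat s (u0 j) x - u0 j x|%:E +
    `|duhamel (source p u j) s x|%:E))%E).
  apply: ge0_le_integral => //.
  - apply/measurable_EFinP/measurableT_comp => //; apply: measurable_funB => //.
    exact: jmeas_space (ju j).
  - by apply: emeasurable_funD; apply/measurable_EFinP/measurableT_comp.
  - move=> x _; rewrite uE// addrAC -EFinD lee_fin; exact: ler_normD.
rewrite ge0_integralD//; [|by apply/measurable_EFinP/measurableT_comp|
  by apply/measurable_EFinP/measurableT_comp].
rewrite [e in leRHS](splitr e) EFinD leeD//; first exact: dP.
apply: le_trans hD _; rewrite lee_fin; apply: (@le_trans _ _ (S * r)).
  by rewrite ler_wpM2l// ltW.
by rewrite /r [S * _]mulrA ler_pdivrMr ?ltr_wpDl// mulrC ler_wpM2l ?(ltW e2)// lerDl.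
Qed.

(** Duhamel's formula has no meaning at t = 0, where the kernel degenerates; the
    datum itself is the value there. *)
Definition with_initial t j : Rn R n -> R := if t <= 0 then u0 j else u t j.

Lemma with_initial_mild : mild_solution p u0 T with_initial.
Proof.
have v0 : with_initial 0 = u0 by apply/funext => j; rewrite /with_initial lexx.
have vE t : 0 < t -> with_initial t = u t.
  by move=> t0; apply/funext => j; rewrite /with_initial leNgt t0.
have kr (r e : R) : 0 < e -> 0 <= r -> r <= e / (k%:R + 1) -> k%:R * r <= e.
  move=> e0 r0 re; apply: (@le_trans _ _ (k%:R * (e / (k%:R + 1)))).
    by rewrite ler_wpM2l.
  rewrite mulrA ler_pdivrMr ?ltr_wpDl// mulrC ler_wpM2l// ?lerDl// ltW//.
have norm_ge0 := @normLp_ge0 R n k.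
have cont t (e : R) : 0 < t -> t < T -> 0 < e ->
    \forall s \near t,
      (normLp 1 (fun j => with_initial s j \- with_initial t j)%R <= e%:E)%E /\
      (normLp +oo (fun j => with_initial s j \- with_initial t j)%R <= e%:E)%E.
  move=> t0 tT e0; have e1 : 0 < e / (k%:R + 1) by rewrite divr_gt0// ltr_wpDl.
  have [del d0 dP] := mild_continuous t0 tT e1.
  near=> s; have [|s0 sT bs] := dP s.
    by rewrite distrC; near: s; apply: cvgr_dist_lt.
  rewrite !vE//; have [h1 h2] := bdd_normLp bs.
  by split; [apply: le_trans h1 _|apply: le_trans h2 _]; rewrite lee_fin kr// ltW.
split; first split.
- move=> t; rewrite in_itv/= le_eqVlt => /andP[/orP[/eqP<-|t0] tT] j.
    by rewrite v0; exact: bdd_Lfun (bu0 j).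
  by rewrite vE//; exact: bdd_Lfun (bu j t0 tT).
- move=> t; rewrite in_itv/= le_eqVlt => /andP[/orP[/eqP<-|t0] tT].
    apply: ecvg0 => // e e0; have e1 : 0 < e / (k%:R + 1) by rewrite divr_gt0// ltr_wpDl.
    have [del d0 dP] := mild_initial e1.
    rewrite near_withinE; near=> s; rewrite /= in_itv/= => /andP[s0 sT].
    have [s0'|s0'|s0'] := ltgtP 0 s; last 2 first.
    + by move: (lt_le_trans s0' s0); rewrite ltxx.
    + rewrite -s0' /normLp big1 ?lee_fin ?ltW// => j _.
      rewrite Lnorm1; under eq_integral do rewrite /= subrr normr0.
      exact: integral0.
    have [|_ bs] := dP s s0'.
      near: s; apply/nbhs_ballP; exists del => //= y; rewrite /ball/= sub0r normrN.
      by apply: le_lt_trans; exact: ler_norm.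
    rewrite v0 vE// /normLp; apply: (@le_trans _ _ (\sum_(j < k) (e / (k%:R + 1))%:E)%E).
      by apply: lee_sum => j _; rewrite Lnorm1; exact: bs.
    rewrite sumEFin sumr_const card_ord -[X in X%:E]mulr_natl lee_fin kr//.
    exact: ltW.
  apply: ecvg0 => // e e0; rewrite near_withinE.
  by apply: filterS (cont t e t0 tT e0) => s [].
- move=> t; rewrite in_itv/= => /andP[t0 tT]; apply: ecvg0 => // e e0.
  by apply: filterS (cont t e t0 tT e0) => s [].
- move=> T'; rewrite in_itv/= => /andP[T'0 T'T].
  exists (k%:R * (`|N0| + `|M|)) => t; rewrite in_itv/= le_eqVlt => /andP[/orP[/eqP<-|t0] tT'].
    rewrite v0; have [_ h] := bdd_normLp bu0; apply: le_trans h _.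
    by rewrite lee_fin ler_wpM2l// ler_wpDr// ler_norm.
  have tT := le_lt_trans tT' T'T.
  rewrite vE//; have [_ h] := bdd_normLp (fun j => bu j t0 tT); apply: le_trans h _.
  by rewrite lee_fin ler_wpM2l// ler_wpDl// ler_norm.
- by rewrite v0 => j; apply: aeW.
- move=> t; rewrite in_itv/= => /andP[t0 tT] j; apply: aeW => x _.
  rewrite vE// (uE j x t0 tT); apply: (congr1 (fun z => heat t (u0 j) x + z)).
  rewrite /duhamel.
  have msrc := jmeas_time x (jmeas_heat t (jmeas_source p j ju)).
  apply: eq_Rintegral_cc; first exact: msrc.
  by move=> s s0 st; rewrite vE.
Unshelve. all: by end_near. Qed.

End mild_existence.

(** * Uniqueness *)
Section uniqueness.
Context {R : realType} {n k : nat}.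
Implicit Types (u v : R -> 'I_k -> Rn R n -> R) (f : Rn R n -> R) (s t c M : R).
Local Notation mu := (@lebesgue_Rn R n).

(** Elements of L^oo are bounded almost everywhere only; truncation gives
    representatives bounded everywhere, to which the heat bounds apply. *)
Definition truncate M f x := if `|f x| <= M then f x else 0.

Lemma measurable_truncate M f : measurable_fun setT f ->
  measurable_fun setT (truncate M f).
Proof.
move=> mf; apply: measurable_fun_ifT => //.
by apply: measurable_fun_ler => //; exact: measurableT_comp.
Qed.

Lemma truncate_le M f x : 0 <= M -> `|truncate M f x| <= M.
Proof. by move=> M0; rewrite /truncate; case: ifP => // _; rewrite normr0. Qed.

Lemma truncate_ae M f : (\forall x \ae mu, `|f x| <= M) ->
  f = truncate M f %[ae mu].
Proof. by apply: filterS => x fx _; rewrite /truncate fx. Qed.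

Lemma heat_sup_ae t f c x : 0 < t -> 0 <= c -> measurable_fun setT f ->
  (\forall y \ae mu, `|f y| <= c) -> `|heat t f x| <= c.
Proof.
move=> t0 c0 mf fc.
rewrite (ae_eq_heat t x mf (measurable_truncate c mf) (truncate_ae fc)).
by apply: heat_sup => // [|y]; [exact: measurable_truncate|exact: truncate_le].
Qed.

Lemma normLp_oo_ae (v : 'I_k -> Rn R n -> R) c j : (normLp +oo v <= c%:E)%E ->
  \forall x \ae mu, `|v j x| <= c.
Proof.
move=> vc; apply: filterS (Lnorm_oo_ae mu (v j)) => x vx.
rewrite -lee_fin; apply: le_trans vx _; apply: le_trans vc.
exact: normLp_ge.
Qed.

(** A mild solution is not assumed to be jointly measurable in (s, x).  Continuity
    in L^oo at positive times makes the integrand of Duhamel's formula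
    continuous in s on ]0, t[, and this is how it becomes measurable. *)
Lemma measurable_heat_continuous (F : R -> Rn R n -> R) t c x :
  (forall s, 0 < s -> s < t -> measurable_fun setT (F s)) ->
  (forall s y, 0 < s -> s < t -> `|F s y| <= c) ->
  (forall s (e : R), 0 < s -> s < t -> 0 < e ->
    \forall r \near s, \forall y \ae mu, `|F r y - F s y| <= e) ->
  measurable_fun `]0, t[ (fun s => heat (t - s) (F s) x).
Proof.
move=> mF Fc Fcont; apply: open_continuous_measurable_fun; first exact: itv_open.
move=> s; rewrite inE/= in_itv/= => /andP[s0 st].
have c0 : 0 <= c by apply: le_trans (Fc s point s0 st).
have ts : 0 < t - s by rewrite subr_gt0.
apply/cvgrPdist_le => e e0; have e2 : 0 < e / 2 by rewrite divr_gt0.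
pose q := 2 * n%:R * c / (t - s) + 1.
have q0 : 0 < q by rewrite ltr_wpDl// divr_ge0 ?mulr_ge0// ltW.
near=> r.
have r0 : 0 < r by near: r; exact: lt_nbhsr.
have rt : r < t by near: r; exact: lt_nbhsl.
have tr : 0 < t - r by rewrite subr_gt0.
have rs : `|s - r| <= e / 2 / q.
  by near: r; apply: cvgr_dist_le => //; rewrite divr_gt0.
rewrite -(subrK (heat (t - r) (F s) x) (heat (t - s) (F s) x)) -addrA (splitr e).
apply: le_trans (ler_normD _ _) _; apply: lerD.
  apply: le_trans (heat_time_sup x tr ts (mF s s0 st) (fun y => Fc s y s0 st)) _.
  have -> : t - s - (t - r) = - (s - r) by ring.
  rewrite normrN; apply: (@le_trans _ _ (e / 2 / q * (2 * n%:R * c / (t - s)))).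
    rewrite [leLHS](_ : _ = `|s - r| * (2 * n%:R * c / (t - s))); last by ring.
    by rewrite ler_wpM2r// divr_ge0 ?mulr_ge0// ltW.
  by rewrite mulrAC ler_pdivrMr// ler_wpM2l ?(ltW e2)// lerDl.
rewrite distrC -(heatB x tr (mF r r0 rt) (mF s s0 st) (fun y => Fc r y r0 rt)
  (fun y => Fc s y s0 st)).
apply: heat_sup_ae => //; first exact: ltW.
  by apply: measurable_funB; exact: mF.
by near: r; exact: Fcont.
Unshelve. all: by end_near. Qed.

Variables (p : 'I_k -> R) (u0 : 'I_k -> Rn R n -> R) (T : R).
Hypothesis p1 : forall j, 1 <= p j.

Definition ae_bounded u M t1 := forall s j, 0 <= s -> s <= t1 ->
  \forall x \ae mu, `|u s j x| <= M.

Lemma solution_class_bounded u t1 : solution_class T u -> 0 < t1 -> t1 < T ->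
  exists2 M, 0 <= M & ae_bounded u M t1.
Proof.
move=> [_ _ _ /(_ t1)]; rewrite in_itv/= => H t0 tT.
have [|M HM] := H; first by rewrite t0.
exists `|M| => // s j s0 st.
have hs : (normLp +oo (u s) <= M%:E)%E by apply: HM; rewrite in_itv/= s0 st.
by apply: filterS (normLp_oo_ae j hs) => x h; exact: le_trans h (ler_norm _).
Qed.

Lemma solution_class_measurable u s j : solution_class T u -> 0 <= s -> s < T ->
  measurable_fun setT (u s j).
Proof.
move=> [/(_ s) + _ _ _] s0 sT; rewrite in_itv/= s0 sT => /(_ isT j)[+ _].
by rewrite inE => /andP[]; rewrite inE.
Qed.

(** The source term of the equation j, from truncated representatives. *)
Let tsource u M j s y := `|truncate M (u s (ordS j)) y| `^ p j.

Let tsource_measurable u M j s : solution_class T u -> 0 <= s -> s < T ->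
  measurable_fun setT (tsource u M j s).
Proof.
move=> cu s0 sT; apply: (measurableT_comp (measurable_powR (p j))).
apply: measurableT_comp => //; apply: measurable_truncate.
exact: solution_class_measurable cu s0 sT.
Qed.

Let tsource_le u M j s y : 0 <= M -> `|tsource u M j s y| <= M `^ p j.
Proof.
move=> M0; rewrite ger0_norm ?powR_ge0//.
by apply: ge0_ler_powR; rewrite ?nnegrE ?truncate_le// (le_trans ler01).
Qed.

Let heat_tsource u M j t1 s t x : solution_class T u -> ae_bounded u M t1 ->
  0 <= s -> s <= t1 -> t1 < T ->
  heat t (source p u j s) x = heat t (tsource u M j s) x.
Proof.
move=> cu bu s0 st tT; have sT := le_lt_trans st tT.
apply: ae_eq_heat.
- apply: (measurableT_comp (measurable_powR (p j))); apply: measurableT_comp => //.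
  exact: solution_class_measurable cu s0 sT.
- exact: tsource_measurable.
- apply: filterS (truncate_ae (bu s (ordS j) s0 st)) => y + _ => /(_ Logic.I) h.
  by rewrite /source /tsource -h.
Qed.

Let tsource_lip u v M L j s t1 c : 0 <= M -> powR_lip (p j) M <= L ->
  ae_bounded u M t1 -> ae_bounded v M t1 -> forall r, 0 <= s -> s <= t1 ->
  0 <= r -> r <= t1 -> 0 <= L ->
  (\forall y \ae mu, `|u s (ordS j) y - v r (ordS j) y| <= c) ->
  \forall y \ae mu, `|tsource u M j s y - tsource v M j r y| <= L * c.
Proof.
move=> M0 lipL bu bv r s0 st r0 rt L0 uv.
have tu := truncate_ae (bu s (ordS j) s0 st).
have tv := truncate_ae (bv r (ordS j) r0 rt).
apply: filterS3 tu tv uv => y /(_ Logic.I) hu /(_ Logic.I) hv huv.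
rewrite /tsource; apply: le_trans (powR_lipP (p1 j) _ _) _.
- exact: truncate_le.
- exact: truncate_le.
- by rewrite -hu -hv; apply: ler_pM => //; exact: powR_lip_ge0.
Qed.

Let tsource_heat_measurable u M j t x : solution_class T u -> 0 <= M ->
  0 < t -> t < T -> ae_bounded u M t ->
  measurable_fun `]0, t[ (fun s => heat (t - s) (tsource u M j s) x).
Proof.
move=> cu M0 t0 tT bu; have [_ _ cont _] := cu.
apply: (@measurable_heat_continuous _ t (M `^ p j)).
- by move=> s s0 st; apply: tsource_measurable => //; [exact: ltW|exact: lt_trans tT].
- by move=> s y _ _; exact: tsource_le.
move=> s e s0 st e0; pose L := powR_lip (p j) M.
have L0 : 0 <= L by exact: powR_lip_ge0.
have e1 : 0 < e / (L + 1) by rewrite divr_gt0// ltr_wpDl.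
have := cont s; rewrite in_itv/= s0 (lt_trans st tT) => /(_ isT) conts.
near=> r.
have r0 : 0 < r by near: r; exact: lt_nbhsr.
have rt : r < t by near: r; exact: lt_nbhsl.
have h : (normLp +oo (fun j => u r j \- u s j)%R <= (e / (L + 1))%:E)%E.
  by near: r; exact: ecvg0_near.
have := @tsource_lip u u M L j r t _ M0 (lexx _) bu bu s (ltW r0) (ltW rt) (ltW s0)
  (ltW st) L0 (normLp_oo_ae (ordS j) h).
apply: filterS => y hy; apply: le_trans hy _.
by rewrite mulrA ler_pdivrMr ?ltr_wpDl// mulrC ler_wpM2l ?(ltW e0)// lerDl.
Unshelve. all: by end_near. Qed.

(** On [0, t1] the difference is almost everywhere at most
    2 M 2^{-m} (1 + s)^e for every m: the case m = 0 is boundedness of u and v,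
    and Duhamel's formula passes from m to m + 1. *)
Lemma mild_unique u v : mild_solution p u0 T u -> mild_solution p u0 T v ->
  forall t, t \in `[0, T[ -> ae_equal (v t) (u t).
Proof.
move=> [cu iu eu] [cv iv ev] t1; rewrite in_itv/= le_eqVlt.
move=> /andP[/orP[/eqP<- _ j|t10 t1T]].
  by apply: filterS2 (iu j) (iv j) => x /(_ Logic.I) -> /(_ Logic.I) -> _.
have [M1 M10 bu1] := solution_class_bounded cu t10 t1T.
have [M2 M20 bv2] := solution_class_bounded cv t10 t1T.
pose M := M1 + M2; have M0 : 0 <= M by exact: addr_ge0.
have bu : ae_bounded u M t1.
  move=> s j s0 st; apply: filterS (bu1 s j s0 st) => x h.
  by apply: le_trans h _; rewrite lerDl.
have bv : ae_bounded v M t1.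
  move=> s j s0 st; apply: filterS (bv2 s j s0 st) => x h.
  by apply: le_trans h _; rewrite lerDr.
pose L := \sum_j powR_lip (p j) M.
have L0 : 0 <= L by apply: sumr_ge0 => j _; exact: powR_lip_ge0.
have lipL j : powR_lip (p j) M <= L.
  by rewrite /L (bigD1 j)//= lerDl; apply: sumr_ge0 => i _; exact: powR_lip_ge0.
pose e := 2 * L * (1 + t1).
have e0 : 0 <= e by rewrite !mulr_ge0// addr_ge0// ltW.
have claim m : forall s j, 0 < s -> s <= t1 ->
    \forall x \ae mu, `|u s j x - v s j x| <= 2 * M / 2 ^+ m * (1 + s) `^ e.
  elim: m => [|m IH] s j s0 st.
    apply: filterS2 (bu s j (ltW s0) st) (bv s j (ltW s0) st) => x hu hv.
    rewrite expr0 divr1; apply: (@le_trans _ _ (2 * M)).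
      by apply: le_trans (ler_normB _ _) _; rewrite mulr_natl mulr2n lerD.
    rewrite ler_peMr ?mulr_ge0//.
    have := @ler_powR R (1 + s) _ 0 e; rewrite powRr0; apply => //.
    by rewrite lerDl ltW.
  have sT := le_lt_trans st t1T.
  have bus : ae_bounded u M s by move=> r i r0 rs; apply: bu => //; exact: le_trans st.
  have bvs : ae_bounded v M s by move=> r i r0 rs; apply: bv => //; exact: le_trans st.
  have := eu s; have := ev s; rewrite in_itv/= s0 sT => /(_ isT j) ev' /(_ isT j) eu'.
  apply: filterS2 eu' ev' => x /(_ Logic.I) -> /(_ Logic.I) ->.
  rewrite opprD addrACA subrr add0r.
  have B0 : 0 <= 2 * M / 2 ^+ m by rewrite divr_ge0 ?mulr_ge0// exprn_ge0.
  rewrite (_ : 2 * M / 2 ^+ m.+1 = 2 * M / 2 ^+ m / 2); last first.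
    by rewrite exprSr invfM mulrA.
  have mu_ := tsource_heat_measurable j x cu M0 s0 sT bus.
  have mv_ := tsource_heat_measurable j x cv M0 s0 sT bvs.
  have E w : solution_class T w -> ae_bounded w M s ->
      measurable_fun `]0, s[ (fun r => heat (s - r) (tsource w M j r) x) ->
      \int[lebesgue_measure]_(r in `[0, s])
         heat (s - r) (fun y => `|w r (ordS j) y| `^ p j) x =
      \int[lebesgue_measure]_(r in `[0, s]) heat (s - r) (tsource w M j r) x.
    move=> cw bw mw; apply/esym/eq_Rintegral_cc => // r r0 rs.
    by rewrite -(@heat_tsource w M j s r _ x cw bw) ?ltW.
  rewrite (E u cu bus mu_) (E v cv bvs mv_).
  have hb w r : solution_class T w -> 0 < r -> r < s ->
      `|heat (s - r) (tsource w M j r) x| <= M `^ p j.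
    move=> cw r0 rs; apply: heat_sup; first by rewrite subr_gt0.
      by apply: tsource_measurable => //; [exact: ltW|exact: lt_trans sT].
    by move=> y; exact: tsource_le.
  apply: (contraction_integral L0 B0 s0 st mu_ mv_ (c := M `^ p j)).
  - by move=> r; exact: hb.
  - by move=> r; exact: hb.
  move=> r r0 rs; have rT := lt_trans rs sT; have sr : 0 < s - r by rewrite subr_gt0.
  have m1 := tsource_measurable M j cu (ltW r0) rT.
  have m2 := tsource_measurable M j cv (ltW r0) rT.
  rewrite -(heatB x sr m1 m2 (c := M `^ p j)); [|by move=> y; exact: tsource_le|
    by move=> y; exact: tsource_le].
  have rt1 : r <= t1 by rewrite ltW// (lt_le_trans rs).
  rewrite -mulrA; apply: heat_sup_ae => //.
  - by rewrite !mulr_ge0 ?powR_ge0// ?invr_ge0 ?exprn_ge0.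
  - exact: measurable_funB.
  - apply: (@tsource_lip u v M L j r t1 _ M0 (lipL j) bu bv r) => //; try exact: ltW.
    exact: IH.
move=> j; have := ae_foralln (fun m => claim m t1 j t10 (lexx _)).
apply: filterS => x hx _; apply/eqP; rewrite eq_sym -subr_eq0 -normr_le0.
pose c m : R := 2 * M * (1 + t1) `^ e / 2 ^+ m.
have cc : c @ \oo --> 0 by exact: cvg_half_pow.
rewrite -(cvg_lim (@norm_hausdorff _ _) cc); apply: limr_ge; first by apply: cvgP cc.
by apply: nearW => m; have := hx m; rewrite mulrAC.
Qed.

End uniqueness.

(** * The exponents *)
Section exponents.
Context {R : realType} (k : nat) (p : 'I_k -> R).
Hypotheses (hk : (0 < k)%N) (p1 : forall j, 1 <= p j) (pN1 : exists j, p j != 1).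

Let p0 j : 0 < p j. Proof. exact: lt_le_trans (p1 j). Qed.

Let P m j := \prod_(i < m) p (iter i (@ordS k) j).

Lemma val_iter_ordS m (j : 'I_k) : val (iter m (@ordS k) j) = ((j + m) %% k)%N.
Proof.
elim: m => [|m IH]; first by rewrite addn0 /= modn_small.
by rewrite iterS /= IH -addn1 modnDml addn1 addnS.
Qed.

Lemma prod_cycle j : P k j = \prod_i p i.
Proof.
have inj : injective (fun i : 'I_k => iter i (@ordS k) j).
  move=> i i' /(congr1 val); rewrite !val_iter_ordS => /eqP.
  by rewrite eqn_modDl !modn_small// => /eqP/val_inj.
by rewrite [RHS](reindex_inj inj).
Qed.

Lemma prod_p_gt1 : 1 < \prod_i p i.
Proof.
have [j pj] := pN1; rewrite (bigD1 j)//=.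
have pj1 : 1 < p j by rewrite lt_neqAle eq_sym pj p1.
apply: lt_le_trans pj1 _; rewrite ler_peMr ?(ltW (p0 j))//.
by apply: (big_ind (fun z => 1 <= z)) => // x y x1 y1; exact: mulr_ege1.
Qed.

(** Multiplying the numerator of alpha_{j+1} by p_j shifts its partial products:
    all but the last one are those of alpha_j, and the last one runs once
    through the cycle and equals the full product. *)
Lemma alpha_rec j : p j * alpha p (ordS j) = alpha p j + 1.
Proof.
have q0 : \prod_i p i - 1 != 0 by rewrite gt_eqF// subr_gt0 prod_p_gt1.
have PS m i : P m.+1 i = p i * P m (ordS i).
  rewrite /P big_ord_recl; congr (_ * _); apply: eq_bigr => l _.
  by rewrite iterSr.
have alphaE i : alpha p i = (\sum_(0 <= h < k.-1) P h.+1 i + 1) / (\prod_i p i - 1).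
  by rewrite /alpha big_mkord.
rewrite !alphaE mulrA; apply: (mulIf q0); rewrite divfK// mulrDl mul1r divfK//.
rewrite mulrDr mulr1 big_distrr/=.
under eq_bigr do rewrite -PS.
have -> : p j = P 1 j by rewrite /P big_ord1.
rewrite -(prod_cycle j) -addrA [1 + _]addrC subrK.
transitivity (\sum_(0 <= h < k.-1.+1) P h.+1 j).
  by rewrite big_nat_recl//= addrC.
by rewrite big_nat_recr//= prednK.
Qed.

Lemma alpha_le_max j : alpha p j <= alpha_max p.
Proof. by rewrite /alpha_max; apply: (le_bigmax _ (alpha p) j). Qed.

End exponents.

(** * Existence for small data *)
Section small_data.
Context {R : realType} (n k : nat) (p : 'I_k -> R).
Hypotheses (hk : (0 < k)%N) (p1 : forall j, 1 <= p j) (pN1 : exists j, p j != 1).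
Hypothesis crit : alpha_max p != n%:R / 2.

(** The rate at which the admissible size of the datum shrinks with T: it is 0
    below the critical value n/2, and then no T is excluded. *)
Definition gap : R := Num.max 0 (alpha_max p - n%:R / 2).

(** ex j is the exponent of 1 + t in the time integral of the j-th source term;
    it is positive off the critical case. *)
Let q : R := n%:R / 2.
Let b j := alpha p j - gap.
Let ex j := 1 + q - p j * b (ordS j).

Lemma gap_ge0 : 0 <= gap. Proof. by rewrite le_max lexx. Qed.

Let b_le j : b j <= q.
Proof.
rewrite /b lerBlDr; apply: le_trans (alpha_le_max p j) _.
by rewrite -lerBlDl le_max lexx orbT.
Qed.

Let exE j : ex j = q - b j + (p j - 1) * gap.
Proof. by rewrite /ex /b mulrBr (alpha_rec hk p1 pN1); ring. Qed.

(** By exE a zero of ex j forces alpha_j = alpha_max > n/2 and p_j = 1; but then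
    alpha_{j+1} = alpha_j + 1 would exceed the maximum. *)
Let ex_gt0 j : 0 < ex j.
Proof.
rewrite exE; have pg : 0 <= (p j - 1) * gap by rewrite mulr_ge0 ?gap_ge0// subr_ge0.
have [bj|bj] := ltP (b j) q; first by rewrite ltr_wpDr// subr_gt0.
have {}bj : b j = q by apply/eqP; rewrite eq_le b_le.
rewrite bj subrr add0r.
have am : alpha_max p <= alpha p j.
  have := alpha_le_max p j; move: bj; rewrite /b /gap /q.
  by case: (leP 0 (alpha_max p - n%:R / 2)) => h; lra.
have gap0 : 0 < gap.
  rewrite lt_neqAle gap_ge0 andbT eq_sym; apply/eqP => g0.
  move: bj; rewrite /b g0 subr0 => aq; move/eqP: crit; apply.
  by rewrite -/q -aq; apply/eqP; rewrite eq_le am alpha_le_max.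
rewrite mulr_gt0// subr_gt0 lt_neqAle p1 andbT eq_sym; apply/eqP => pj.
have := alpha_rec hk p1 pN1 j; rewrite pj mul1r => ar.
have := le_trans (alpha_le_max p (ordS j)) am; rewrite ar; lra.
Qed.

Let K : R := 2 `^ q.
Let E : R := \sum_j (ex j)^-1.
(** Chosen so that K * eta / ex j <= 1/2 for all j. *)
Let eta : R := (2 * K * (E + 1))^-1.

Let K_gt0 : 0 < K. Proof. exact: powR_gt0. Qed.
Let E_ge0 : 0 <= E.
Proof. by apply: sumr_ge0 => j _; rewrite invr_ge0 ltW. Qed.
Let eta_gt0 : 0 < eta.
Proof. by rewrite invr_gt0 !mulr_gt0// ltr_wpDl. Qed.

(** Below this size the linear part of Duhamel's formula takes at most half of
    each majorant. *)
Definition data_size : R := \big[Num.min/1]_j (eta `^ alpha p j / (2 * K)).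

Lemma data_size_gt0 : 0 < data_size.
Proof.
by apply/bigmin_gtP; split=> // j _; rewrite divr_gt0 ?powR_gt0// mulr_gt0.
Qed.

(** The two halves of the majorant a_j accommodate the linear part, by the bound
    on the datum, and the integral, by the choice of eta. *)
Lemma exists_mild (u0 : 'I_k -> Rn R n -> R) (T N0 : R) : 0 < T ->
  (forall j, bdd N0 N0 (u0 j)) -> N0 * (1 + T) `^ gap <= data_size ->
  exists u, mild_solution p u0 T u.
Proof.
move=> T0 bu0 small; pose S := 1 + T; have S0 : 0 < S by rewrite addr_gt0.
pose A j := eta `^ alpha p j * S `^ (- gap).
have A0 j : 0 < A j by rewrite mulr_gt0 ?powR_gt0.
pose a j t := A j * (1 + t) `^ (q - b j).
pose g j t := A (ordS j) `^ p j * (1 + t) `^ (ex j - 1).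
pose G j t := A (ordS j) `^ p j * ((1 + t) `^ ex j / ex j).
pose D := \sum_j A j * S `^ (q - b j).
have t1 (t : R) : 0 < t -> 0 < 1 + t by move=> t0; rewrite addr_gt0.
have a_ge0 j t : 0 < t -> t < T -> 0 <= a j t.
  by move=> _ _; rewrite mulr_ge0 ?powR_ge0// ltW.
have a_le j t : 0 < t -> t < T -> a j t <= D.
  move=> t0 tT; apply: (@le_trans _ _ (A j * S `^ (q - b j))).
    rewrite ler_wpM2l ?(ltW (A0 j))//; apply: ge0_ler_powR.
    - by rewrite subr_ge0.
    - by rewrite nnegrE ltW// t1.
    - by rewrite nnegrE ltW.
    - by rewrite lerD2l ltW.
  rewrite /D (bigD1 j)//= lerDl; apply: sumr_ge0 => i _.
  by rewrite mulr_ge0 ?powR_ge0// ltW.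
have mg j : measurable_fun setT (g j).
  by apply: measurable_funM => //; exact: measurable_1Dpow.
have pow_le j t : 0 < t -> t < T ->
    a (ordS j) t `^ p j * (1 + t) `^ (- (n%:R / 2)) `^ (p j - 1) <= g j t.
  move=> t0 tT; rewrite /a powRM ?powR_ge0 ?(ltW (A0 _))// -!powRrM -mulrA -powRD; last first.
    by rewrite (gt_eqF (t1 t t0)) implybT.
  rewrite le_eqVlt; apply/orP; left; apply/eqP; congr (_ * _ `^ _).
  by rewrite /ex -/q; ring.
have int_g j t : 0 < t -> t < T ->
    (\int[lebesgue_measure]_(s in `]0%R, t[) (g j s)%:E <= (G j t)%:E)%E.
  move=> t0 tT; under eq_integral do rewrite EFinM.
  rewrite ge0_integralZl//; first last.
  - by rewrite lee_fin powR_ge0.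
  - by move=> s _; rewrite lee_fin powR_ge0.
  - by apply/measurable_EFinP; exact: measurable_1Dpow.
  rewrite /G EFinM lee_wpmul2l ?lee_fin ?powR_ge0//.
  exact: integral_1Dpow.
have majorant j t : 0 < t -> t < T -> K * N0 + K * G j t <= a j t.
  move=> t0 tT; have tt := t1 t t0.
  rewrite (splitr (a j t)) lerD//.
    have Aa : A j <= a j t.
      rewrite ler_peMr ?(ltW (A0 j))//.
      have := @ler_powR R (1 + t) _ 0 (q - b j); rewrite powRr0; apply.
        by rewrite lerDl ltW.
      by rewrite subr_ge0.
    apply: (@le_trans _ _ (A j / 2)); last by rewrite ler_wpM2r.
    have : data_size <= eta `^ alpha p j / (2 * K) by exact: bigmin_le.
    move=> /(le_trans small); rewrite -/S.
    rewrite -(@ler_pM2r _ (K * S `^ (- gap))); last by rewrite mulr_gt0// powR_gt0.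
    rewrite (_ : N0 * _ * _ = K * N0); last first.
      rewrite [K * _]mulrC mulrA -[N0 * _ * _]mulrA powRN mulfV ?mulr1 1?mulrC//.
      by rewrite gt_eqF// powR_gt0.
    rewrite (_ : _ / _ * _ = A j / 2)// /A; field.
    by rewrite gt_eqF.
  have Ap : A (ordS j) `^ p j = eta * A j * S `^ (- ((p j - 1) * gap)).
    rewrite /A powRM ?powR_ge0// -!powRrM mulrC [alpha _ _ * _]mulrC.
    rewrite (alpha_rec hk p1 pN1) powRD; last by rewrite (gt_eqF eta_gt0) implybT.
    rewrite powRr1 ?(ltW eta_gt0)// [X in _ = X]mulrC.
    rewrite (_ : - gap * p j = - ((p j - 1) * gap) + - gap); last by ring.
    by rewrite powRD ?(gt_eqF S0) ?implybT//; ring.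
  have tS : (1 + t) `^ ((p j - 1) * gap) * S `^ (- ((p j - 1) * gap)) <= 1.
    rewrite powRN ler_pdivrMr ?powR_gt0// mul1r; apply: ge0_ler_powR.
    - by rewrite mulr_ge0 ?gap_ge0// subr_ge0.
    - by rewrite nnegrE ltW.
    - by rewrite nnegrE ltW.
    - by rewrite lerD2l ltW.
  have -> : K * G j t = (K * eta / ex j) * a j t *
      ((1 + t) `^ ((p j - 1) * gap) * S `^ (- ((p j - 1) * gap))).
    rewrite /G Ap {1}exE powRD; last by rewrite (gt_eqF tt) implybT.
    by rewrite /a; ring.
  have Ke : K * eta / ex j <= 2^-1.
    have exE' : (ex j)^-1 <= E + 1.
      rewrite /E (bigD1 j)//= -addrA lerDl addr_ge0//.
      by apply: sumr_ge0 => i _; rewrite invr_ge0 ltW.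
    apply: (@le_trans _ _ (K * eta * (E + 1))).
      by rewrite ler_wpM2l// mulr_ge0 ?ltW.
    rewrite /eta le_eqVlt; apply/orP; left; apply/eqP; field.
    by rewrite !gt_eqF// ltr_wpDl.
  have at0 : 0 <= a j t by exact: a_ge0.
  apply: (@le_trans _ _ (K * eta / ex j * a j t)).
    rewrite ler_piMr// mulr_ge0// divr_ge0 ?ltW// mulr_gt0//.
  by rewrite [leRHS]mulrC ler_wpM2r.
have [u [ju bu] uE] := picard_exists p1 bu0 a_ge0 a_le mg pow_le int_g majorant T0.
exists (with_initial u0 u); apply: (with_initial_mild p1 bu0 T0 ju _ uE (M := D)).
move=> t j t0 tT; apply: bddS (bu t j t0 tT); last exact: a_le.
apply: le_trans (a_le j t t0 tT); rewrite ler_piMr ?a_ge0//.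
have := @le_powRN R 1 (1 + t) (n%:R / 2); rewrite powR1; apply => //.
by rewrite lerDl ltW.
Qed.

End small_data.

(** * The lifespan *)
Section lifespan.
Context {R : realType} (n k : nat) (p : 'I_k -> R).
Local Notation mu := (@lebesgue_Rn R n).

Lemma bdd_representative (u0 : 'I_k -> Rn R n -> R) (N : R) : in_L1Linfty u0 ->
  (normL1Linfty u0 <= N%:E)%E ->
  ae_equal u0 (fun j => truncate N (u0 j)) /\
  forall j, bdd N N (truncate N (u0 j)).
Proof.
move=> Lu0 uN.
have pos q := normLp_ge0 q u0.
have N0 : 0 <= N by rewrite -lee_fin; apply: le_trans uN; exact: normL1Linfty_ge0.
have hoo : (normLp +oo u0 <= N%:E)%E by apply: le_trans uN; rewrite leeDr.
have h1 : (normLp 1 u0 <= N%:E)%E by apply: le_trans uN; rewrite leeDl.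
have mu0 j : measurable_fun setT (u0 j).
  by have [+ _] := Lu0 j; rewrite inE => /andP[]; rewrite inE.
split=> j; first exact: truncate_ae (normLp_oo_ae j hoo).
split; first exact: measurable_truncate.
- by move=> x; exact: truncate_le.
- apply: le_trans h1; apply: le_trans (normLp_ge 1 u0 j); rewrite Lnorm1.
  apply: ge0_le_integral => //.
  + by apply/measurable_EFinP/measurableT_comp => //; exact: measurable_truncate.
  + by apply/measurable_EFinP/measurableT_comp.
  + by move=> x _; rewrite lee_fin /truncate; case: ifP => // _; rewrite normr0.
Qed.

(** The heat flow sees the datum up to a null set only, so a solution that starts
    from a bounded representative starts from the datum itself. *)
Lemma mild_solution_ae (u0 u1 : 'I_k -> Rn R n -> R) T u : (forall j, measurable_fun setT (u0 j)) ->
  (forall j, measurable_fun setT (u1 j)) -> ae_equal u0 u1 ->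
  mild_solution p u1 T u -> mild_solution p u0 T u.
Proof.
move=> m0 m1 u01 [cu iu eu]; split => //.
  by move=> j; apply: filterS2 (iu j) (u01 j) => x /(_ Logic.I) -> /(_ Logic.I) ->.
move=> t tT j; have := eu t tT j; apply: filterS => x /(_ Logic.I) -> _.
by rewrite (ae_eq_heat t x (m0 j) (m1 j) (u01 j)).
Qed.

Lemma lifespan_ge (u0 : 'I_k -> Rn R n -> R) T : 0 < T -> uniquely_solvable p u0 T ->
  (T%:E <= lifespan p u0)%E.
Proof. by move=> T0 sT; apply: ereal_sup_ubound; exists T. Qed.

End lifespan.

Theorem proposition1p3 (R : realType) (n k : nat) (hn : (0 < n)%N)
    (hk : (0 < k)%N) (p : 'I_k -> R) (hp : forall j, 1 <= p j)
    (hp1 : exists j, p j != 1) :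
  exists eps0 C : R, [/\ 0 < eps0, 0 < C &
    forall u0 : 'I_k -> Rn R n -> R,
      in_L1Linfty u0 ->
      (normL1Linfty u0 <= eps0%:E)%E ->
      (alpha_max p < n%:R / 2 -> lifespan p u0 = +oo%E) /\
      (n%:R / 2 < alpha_max p ->
        (C%:E * (normL1Linfty u0 `^ (1 / (alpha_max p - n%:R / 2)))^-1
          <= lifespan p u0)%E)].
Proof.
(* Nothing is claimed in the critical case. *)
have [crit|crit] := eqVneq (alpha_max p) (n%:R / 2).
  by exists 1, 1; split=> // u0 _ _; rewrite crit ltxx.
pose c0 := data_size n p; pose d := gap n p.
have c0p : 0 < c0 by exact: data_size_gt0.
have d0 : 0 <= d by exact: gap_ge0.
(* In the condition N (1 + T)^d <= c0 for solvability up to T, the first constant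
   makes 1 take at most half of (c0 / N)^{1/d}; T may take the other half. *)
exists (c0 * 2 `^ (- d)), (c0 `^ (1 / d) / 2).
have p2 : 0 < 2 `^ (- d) :> R by rewrite powR_gt0.
split; [by rewrite mulr_gt0|by rewrite divr_gt0// powR_gt0|].
move=> u0 Lu0 small.
have solv (N T : R) : 0 < T -> (normL1Linfty u0 <= N%:E)%E ->
    N * (1 + T) `^ d <= c0 -> (T%:E <= lifespan p u0)%E.
  move=> T0 uN NT; apply: lifespan_ge => //.
  have [u01 bu1] := bdd_representative Lu0 uN.
  have [u mu] := exists_mild hk hp hp1 crit T0 bu1 NT.
  have {}mu : mild_solution p u0 T u.
    apply: mild_solution_ae mu => // j; last by case: (bu1 j).
    by have [+ _] := Lu0 j; rewrite inE => /andP[]; rewrite inE.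
  exists u; split=> // v mv; exact: mild_unique mu mv.
have fin : normL1Linfty u0 \is a fin_num.
  rewrite ge0_fin_numE ?normL1Linfty_ge0//; apply: le_lt_trans small _.
  by rewrite ltry.
pose N := fine (normL1Linfty u0); have NE : normL1Linfty u0 = N%:E by rewrite fineK.
have N0 : 0 <= N by rewrite fine_ge0// normL1Linfty_ge0.
have Nsmall : N <= c0 * 2 `^ (- d) by rewrite -lee_fin -NE.
split=> [sub|sup].
  have dE : d = 0 by rewrite /d /gap max_l// subr_le0 ltW.
  apply/eqyP => A A0; apply: (solv N A A0); first by rewrite NE.
  by rewrite dE powRr0 mulr1; move: Nsmall; rewrite dE oppr0 powRr0 mulr1.
have dE : d = alpha_max p - n%:R / 2 by rewrite /d /gap max_r// subr_ge0 ltW.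
have dp : 0 < d by rewrite dE subr_gt0.
rewrite -dE NE poweR_EFin.
have [Nz|Nz] := eqVneq N 0.
  suff -> : lifespan p u0 = +oo%E by rewrite leey.
  apply/eqyP => A A0; apply: (solv N A A0); first by rewrite NE.
  by rewrite Nz mul0r ltW.
have Np : 0 < N by rewrite lt_neqAle eq_sym Nz.
have Nd : 0 < N `^ (1 / d) by rewrite powR_gt0.
rewrite inver gt_eqF// -EFinM; apply: (solv N).
- by rewrite !mulr_gt0// ?invr_gt0// powR_gt0.
- by rewrite NE.
set T := _ / _ / _.
have T0 : 0 < T by rewrite !mulr_gt0// ?invr_gt0// powR_gt0.
have h : N `^ (1 / d) * (1 + T) <= c0 `^ (1 / d).
  rewrite mulrDr mulr1 (splitr (c0 `^ (1 / d))) /T mulrCA mulfV ?gt_eqF// mulr1.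
  rewrite lerD2r; apply: (@le_trans _ _ ((c0 * 2 `^ (- d)) `^ (1 / d))).
    apply: ge0_ler_powR => //; first by rewrite divr_ge0.
    by rewrite nnegrE mulr_ge0// ltW.
  rewrite powRM ?(ltW c0p) ?(ltW p2)// -powRrM mulNr mulrCA mulfV ?gt_eqF// mulr1.
  by rewrite powR_inv1.
have hd : (N `^ (1 / d) * (1 + T)) `^ d <= (c0 `^ (1 / d)) `^ d.
  apply: ge0_ler_powR => //; rewrite nnegrE; last exact: powR_ge0.
  by rewrite mulr_ge0 ?powR_ge0// addr_ge0// ltW.
move: hd; rewrite powRM ?powR_ge0//; last by rewrite addr_ge0// ltW.
by rewrite -!powRrM mul1r mulVf ?(gt_eqF dp)// !powRr1 ?(ltW c0p).
Qed.
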